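(* Let $(\mathbb X,\mathbb T)$ be a Cartesian tangent category and let $G$ be a group object of $\mathbb X$. The following statements are equivalent: (1) $G$ is a Lie group (i.e. $G$ admits a tangent space at the unit); (2) $G$ admits negatives and its Lie functor is tangently representable; (3) $G$ admits negatives and its Lie functor is differentiably representable; (4) $G$ is parallelizable.
   Context: Conventions. Composition is diagrammatic: $fg$ means first $f$, then $g$; $\langle f,g\rangle$ is pairing, $\pi_i$ are projections, $*$ is the terminal object and $!$ denotes maps to $*$. Tangent categories. A tangent structure $\mathbb T=(T,p,z,s,l,c)$ on a category $\mathbb X$ consists of an endofunctor $T$ and natural transformations $p_M:TM\to M$, $z_M:M\to TM$, $s_M:T_2M\to TM$, $l_M:TM\to TTM$, $c_M:TTM\to TTM$, where the $n$-fold pullback $T_nM$ of $p_M$ along itself exists and is preserved by all $T^k$, such that: $(p_M,z_M,s_M)$ is an additive bundle (a commutative monoid in $\mathbb X/M$); $(z_M,l_M):(p_M,z_M,s_M)\to(Tp_M,Tz_M,Ts_M)$ and $(\mathrm{id}_{TM},c_M):(p_{TM},z_{TM},s_{TM})\to(Tp_M,Tz_M,Ts_M)$ are additive bundle morphisms; $l_M\,Tl_M=l_M\,l_{TM}$, $c_Mc_M=\mathrm{id}$, $Tc_M\,c_{TM}\,Tc_M=c_{TM}\,Tc_M\,c_{TM}$, $l_Mc_M=l_M$, $l_{TM}\,Tc_M\,c_{TM}=c_M\,Tl_M$; and, with $\xi_M:=(z_{TM}\times l_M)\,Ts_M:T_2M\to TTM$, the square $\xi_M\,Tp_M=\pi_1p_Mz_M$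 exhibits $T_2M$ as the pullback of $Tp_M$ along $z_M$. It is Cartesian if $\mathbb X$ has finite products and $T$ preserves them (we identify $T(A\times B)=TA\times TB$). An object $M$ admits negatives if there is $n_M:TM\to TM$ with $n_Mp_M=p_M$ and $\langle\mathrm{id},n_M\rangle s_M=p_Mz_M$. A tangent pullback is a pullback preserved by all $T^n$, $n\ge 0$. Group objects. A group object $G$ has unit $\mathsf e:*\to G$, multiplication $\mathsf m_G:G\times G\to G$ and inverse $\mathsf i_G$. Each $T^nG$ is a group object with structure maps $T^n\mathsf e,T^n\mathsf m_G,T^n\mathsf i_G$. $G$ is a Lie group if it admits a tangent space at the unit: the pullback $T_{\mathsf e}G$ of $p_G$ along $\mathsf e$ exists and is a tangent pullback. Lie functor. For an object $A$, an $A$-PLIVF ($A$-parametrized left-invariant vector field) on $G$ is a map $X:G\times A\to TG$ with $Xp_G=\pi_1$ and $(\mathsf m_G\times\mathrm{id}_A)X=(z_G\times X)\,T\mathsf m_G$ (maps $G\times G\times A\to TG$). Let $\mathfrak g(A)$ be the set of $A$-PLIVFs; for $f:A\to B$ put $\mathfrak g(f)(X)=(\mathrm{id}_G\times f)X$. This contravariant functor $\mathfrak g(-)$ to $\mathbf{Set}$ is the Lie functor of $G$. Let $(T^n\mathfrak g)(-)$ be the Lie functor of $T^nG$, and let $\tau_A^{T^nG}:(T^n\mathfrak g)(A)\to(T^{n+1}\mathfrak g)(TA)$ send $X$ to $TX\,c_{T^nG}$. The Lie functor is tangently representable if there is an object $\mathfrak g$ and, for every $n\ge0$, an isomorphism $\varphi_A^{T^nG}:(T^n\mathfrak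 g)(A)\to\mathbb X(A,T^n\mathfrak g)$ natural in $A$, such that $\varphi_{TA}^{T^{n+1}G}(\tau_A^{T^nG}(X))=T(\varphi_A^{T^nG}(X))$ for all $n,A,X$. Differential objects. A differential object is a commutative monoid $(A,0_A,+_A)$ in $\mathbb X$ with $\hat p_A:TA\to A$ such that $z_A\hat p_A={!}0_A$, $s_A\hat p_A=(\hat p_A\times\hat p_A)+_A$, $T0_A\,\hat p_A=0_A$ (identifying $T*=*$), $T{+_A}\,\hat p_A=(\hat p_A\times\hat p_A)+_A$, $l_A\,T\hat p_A\,\hat p_A=\hat p_A$, and $\langle p_A,\hat p_A\rangle:TA\to A\times A$ is invertible. Its vertical lift $\lambda_A:A\to TA$ is the unique map with $\lambda_Ap_A={!}0_A$, $\lambda_A\hat p_A=\mathrm{id}_A$. For differential objects $A_1,\dots,A_n$ let $\lambda_k=z_{A_1}\times\dots\times\lambda_{A_k}\times\dots\times z_{A_n}$. A map $f:A_1\times\dots\times A_n\to B$ to a differential object is multilinear if $\lambda_k\,Tf=f\lambda_B$ for each $k$. An $(A_1\times\dots\times A_n)$-PLIVF $X$ is multilinear if $(z_G\times\lambda_k)\,TX=X\,l_G$ for each $k$. The Lie functor is differentiably representable if it is representable via some $\varphi_A:\mathfrak g(A)\cong\mathbb X(A,\mathfrak g)$, the representing object $\mathfrak g$ is a differential object, and, for all lists of differential objects $A_1,\dots,A_n$, $\varphi_{A_1\times\dots\times A_n}$ sends multilinear PLIVFs to multilinear maps and $\varphi^{-1}_{A_1\times\dots\times A_n}$ sends multilinear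 maps to multilinear PLIVFs. An object $M$ is parallelizable if there are a differential object $\mathfrak m$ and an isomorphism $\nu_M:TM\cong M\times\mathfrak m$ which is linear, i.e. $\nu_M(z_M\times\lambda_{\mathfrak m})=l_M\,T\nu_M$. *)

(* Defs.v *)
From mathcomp Require Import all_boot.

Set Implicit Arguments.
Unset Strict Implicit.
Unset Printing Implicit Defensive.

Record category := Category {
  ob :> Type;
  hom : ob -> ob -> Type;
  idm : forall A, hom A A;
  comp : forall A B C, hom A B -> hom B C -> hom A C;
  comp_idl : forall A B (f : hom A B), comp (idm A) f = f;
  comp_idr : forall A B (f : hom A B), comp f (idm B) = f;
  comp_assoc : forall A B C D (f : hom A B) (g : hom B C) (h : hom C D),
    comp f (comp g h) = comp (comp f g) h
}.

Arguments hom {_} _ _.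
Arguments idm {_} _.
Arguments comp {_ _ _ _} _ _.

(* Diagrammatic order: first f, then g. *)
Notation "f ;; g" := (comp f g) (at level 50, left associativity).

Definition is_pullback (X : category) (A B C P : X)
    (f : hom A C) (g : hom B C) (p1 : hom P A) (p2 : hom P B) : Prop :=
  p1 ;; f = p2 ;; g /\
  forall (Z : X) (u : hom Z A) (v : hom Z B), u ;; f = v ;; g ->
    exists! h : hom Z P, h ;; p1 = u /\ h ;; p2 = v.

Record endofunctor (X : category) := Endofunctor {
  fob :> X -> X;
  fmap : forall A B : X, hom A B -> hom (fob A) (fob B);
  fmap_id : forall A : X, fmap (idm A) = idm (fob A);
  fmap_comp : forall (A B C : X) (f : hom A B) (g : hom B C),
    fmap (f ;; g) = fmap f ;; fmap g
}.

Arguments fmap {_} _ {_ _} _.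

(* The action of the n-th iterate of F on maps; on objects it is [iter n F]. *)
Fixpoint iter_fmap (X : category) (F : endofunctor X) (n : nat) (A B : X)
    (f : hom A B) : hom (iter n F A) (iter n F B) :=
  match n return hom (iter n F A) (iter n F B) with
  | 0 => f
  | m.+1 => fmap F (iter_fmap F m f)
  end.

Definition is_tangent_pullback (X : category) (F : endofunctor X)
    (A B C P : X) (f : hom A C) (g : hom B C)
    (p1 : hom P A) (p2 : hom P B) : Prop :=
  forall k, is_pullback (iter_fmap F k f) (iter_fmap F k g)
                        (iter_fmap F k p1) (iter_fmap F k p2).

(* The projections [pr i : P -> E], over [b : P -> M], exhibit P as the n-fold
   pullback of [q : E -> M] along itself. *)
Definition is_fibre_power (X : category) (E M : X) (q : hom E M) (n : nat)
    (P : X) (b : hom P M) (pr : 'I_n -> hom P E) : Prop :=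
  (forall i, pr i ;; q = b) /\
  forall (Z : X) (w : hom Z M) (u : 'I_n -> hom Z E),
    (forall i, u i ;; q = w) ->
    exists! h : hom Z P, h ;; b = w /\ forall i, h ;; pr i = u i.

(* Data of a (candidate) additive bundle [bq : E -> M]; [b2] stands for the
   pullback of [bq] along itself. *)
Record bundle_data (X : category) (M E : X) := BundleData {
  bq : hom E M;
  bz : hom M E;
  b2 : X;
  bpr1 : hom b2 E;
  bpr2 : hom b2 E;
  bs : hom b2 E
}.

(* A commutative monoid in the slice over M.  Pairings <u, v> into the pullback
   [b2] are represented by maps h with [h ;; bpr1 = u] and [h ;; bpr2 = v]
   (there is exactly one such h as soon as [u ;; bq = v ;; bq]), and the monoid
   laws are the usual diagrams read on generalized elements. *)
Record is_additive_bundle (X : category) (M E : X) (B : bundle_data M E)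
    : Prop := IsAdditiveBundle {
  ab_pullback : is_pullback (bq B) (bq B) (bpr1 B) (bpr2 B);
  ab_zero_over : bz B ;; bq B = idm M;
  ab_add_over : bs B ;; bq B = bpr1 B ;; bq B;
  ab_add0 : forall (Z : X) (h : hom Z (b2 B)),
    h ;; bpr2 B = h ;; bpr1 B ;; bq B ;; bz B -> h ;; bs B = h ;; bpr1 B;
  ab_addC : forall (Z : X) (h k : hom Z (b2 B)),
    k ;; bpr1 B = h ;; bpr2 B -> k ;; bpr2 B = h ;; bpr1 B ->
    h ;; bs B = k ;; bs B;
  (* With uv = <u, v> and vw = <v, w>: (u + v) + w = u + (v + w). *)
  ab_addA : forall (Z : X) (uv vw uv_w u_vw : hom Z (b2 B)),
    uv ;; bpr2 B = vw ;; bpr1 B ->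
    uv_w ;; bpr1 B = uv ;; bs B -> uv_w ;; bpr2 B = vw ;; bpr2 B ->
    u_vw ;; bpr1 B = uv ;; bpr1 B -> u_vw ;; bpr2 B = vw ;; bs B ->
    uv_w ;; bs B = u_vw ;; bs B
}.

(* [f] is the map between the bases and [g] the map between the total spaces. *)
Record is_additive_bundle_morphism (X : category) (M E M' E' : X)
    (B : bundle_data M E) (B' : bundle_data M' E')
    (f : hom M M') (g : hom E E') : Prop := IsAdditiveBundleMorphism {
  abm_over : g ;; bq B' = bq B ;; f;
  abm_zero : bz B ;; g = f ;; bz B';
  abm_add : forall h : hom (b2 B) (b2 B'),
    h ;; bpr1 B' = bpr1 B ;; g -> h ;; bpr2 B' = bpr2 B ;; g ->
    bs B ;; g = h ;; bs B'
}.

Definition fmap_bundle (X : category) (F : endofunctor X) (M E : X)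
    (B : bundle_data M E) : bundle_data (F M) (F E) :=
  BundleData (fmap F (bq B)) (fmap F (bz B))
    (fmap F (bpr1 B)) (fmap F (bpr2 B)) (fmap F (bs B)).

(* The object [tan2 M], with its projections [tan_pr1] and [tan_pr2], is a
   choice of T_2 M. *)
Record tangent_structure (X : category) := TangentStructure {
  tan :> endofunctor X;
  tan2 : X -> X;
  tan_pr1 : forall M : X, hom (tan2 M) (tan M);
  tan_pr2 : forall M : X, hom (tan2 M) (tan M);
  tan_p : forall M : X, hom (tan M) M;
  tan_z : forall M : X, hom M (tan M);
  tan_s : forall M : X, hom (tan2 M) (tan M);
  tan_l : forall M : X, hom (tan M) (tan (tan M));
  tan_c : forall M : X, hom (tan (tan M)) (tan (tan M));
  tan_bundle := fun M : X =>
    BundleData (tan_p M) (tan_z M) (tan_pr1 M) (tan_pr2 M) (tan_s M);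

  tan_p_nat : forall (M N : X) (f : hom M N),
    fmap tan f ;; tan_p N = tan_p M ;; f;
  tan_z_nat : forall (M N : X) (f : hom M N),
    f ;; tan_z N = tan_z M ;; fmap tan f;
  (* The map h below is T_2 f. *)
  tan_s_nat : forall (M N : X) (f : hom M N) (h : hom (tan2 M) (tan2 N)),
    h ;; tan_pr1 N = tan_pr1 M ;; fmap tan f ->
    h ;; tan_pr2 N = tan_pr2 M ;; fmap tan f ->
    h ;; tan_s N = tan_s M ;; fmap tan f;
  tan_l_nat : forall (M N : X) (f : hom M N),
    fmap tan f ;; tan_l N = tan_l M ;; fmap tan (fmap tan f);
  tan_c_nat : forall (M N : X) (f : hom M N),
    fmap tan (fmap tan f) ;; tan_c N = tan_c M ;; fmap tan (fmap tan f);

  tan2_pullback : forall M : X,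
    is_tangent_pullback tan (tan_p M) (tan_p M) (tan_pr1 M) (tan_pr2 M);
  tan_fibre_powers : forall (n : nat) (M : X),
    exists (P : X) (b : hom P M) (pr : 'I_n -> hom P (tan M)),
    forall k, is_fibre_power (iter_fmap tan k (tan_p M))
                (iter_fmap tan k b) (fun i => iter_fmap tan k (pr i));

  tan_additive : forall M : X, is_additive_bundle (tan_bundle M);
  tan_l_additive : forall M : X,
    is_additive_bundle_morphism (tan_bundle M) (fmap_bundle tan (tan_bundle M))
      (tan_z M) (tan_l M);
  tan_c_additive : forall M : X,
    is_additive_bundle_morphism (tan_bundle (tan M))
      (fmap_bundle tan (tan_bundle M)) (idm (tan M)) (tan_c M);

  tan_l_Tl : forall M : X,
    tan_l M ;; fmap tan (tan_l M) = tan_l M ;; tan_l (tan M);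
  tan_cc : forall M : X, tan_c M ;; tan_c M = idm (tan (tan M));
  tan_ccc : forall M : X,
    fmap tan (tan_c M) ;; tan_c (tan M) ;; fmap tan (tan_c M) =
    tan_c (tan M) ;; fmap tan (tan_c M) ;; tan_c (tan M);
  tan_lc : forall M : X, tan_l M ;; tan_c M = tan_l M;
  tan_lcc : forall M : X,
    tan_l (tan M) ;; fmap tan (tan_c M) ;; tan_c (tan M) =
    tan_c M ;; fmap tan (tan_l M);

  (* Universality of the vertical lift: the map h is
     z_{TM} x l_M : T_2 M -> T (T_2 M), so that [h ;; T s_M] is xi_M. *)
  tan_universal : forall (M : X) (h : hom (tan2 M) (tan (tan2 M))),
    h ;; fmap tan (tan_pr1 M) = tan_pr1 M ;; tan_z (tan M) ->
    h ;; fmap tan (tan_pr2 M) = tan_pr2 M ;; tan_l M ->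
    is_pullback (fmap tan (tan_p M)) (tan_z M)
      (h ;; fmap tan (tan_s M)) (tan_pr1 M ;; tan_p M)
}.

Record finite_products (X : category) := FiniteProducts {
  one : X;
  bang : forall A : X, hom A one;
  bang_uniq : forall (A : X) (f : hom A one), f = bang A;
  cprod : X -> X -> X;
  pi1 : forall A B : X, hom (cprod A B) A;
  pi2 : forall A B : X, hom (cprod A B) B;
  cpair : forall Z A B : X, hom Z A -> hom Z B -> hom Z (cprod A B);
  cpair_pi1 : forall (Z A B : X) (f : hom Z A) (g : hom Z B),
    cpair f g ;; pi1 A B = f;
  cpair_pi2 : forall (Z A B : X) (f : hom Z A) (g : hom Z B),
    cpair f g ;; pi2 A B = g;
  cpair_uniq : forall (Z A B : X) (h : hom Z (cprod A B)),
    h = cpair (h ;; pi1 A B) (h ;; pi2 A B)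
}.

(* F preserves finite products: the canonical maps F 1 -> 1 and
   F (A x B) -> F A x F B have inverses, here [Fone] and [Fprod]. *)
Record preserves_products (X : category) (P : finite_products X)
    (F : endofunctor X) := PreservesProducts {
  Fone : hom (one P) (F (one P));
  bang_Fone : bang P (F (one P)) ;; Fone = idm (F (one P));
  Fprod : forall A B : X, hom (cprod P (F A) (F B)) (F (cprod P A B));
  Fprod_split : forall A B : X,
    Fprod A B ;; cpair P (fmap F (pi1 P A B)) (fmap F (pi2 P A B)) =
    idm (cprod P (F A) (F B));
  split_Fprod : forall A B : X,
    cpair P (fmap F (pi1 P A B)) (fmap F (pi2 P A B)) ;; Fprod A B =
    idm (F (cprod P A B))
}.

Record cartesian_tangent_category := CartesianTangentCategory {
  ctc_cat :> category;
  ctc_prod : finite_products ctc_cat;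
  ctc_tan : tangent_structure ctc_cat;
  ctc_pres : preserves_products ctc_prod ctc_tan
}.


Definition is_iso (X : category) (A B : X) (f : hom A B) : Prop :=
  exists g : hom B A, f ;; g = idm A /\ g ;; f = idm B.

Section CartesianTangent.

Variable X : cartesian_tangent_category.

Local Notation T := (tan (ctc_tan X)).
Local Notation "A ** B" := (cprod (ctc_prod X) A B)
  (at level 40, left associativity).
Local Notation "⟨ f , g ⟩" := (cpair (ctc_prod X) f g) (at level 0).
Local Notation "1" := (one (ctc_prod X)).
Local Notation "!" := (bang (ctc_prod X) _) (at level 0).
Local Notation π1 := (pi1 (ctc_prod X) _ _).
Local Notation π2 := (pi2 (ctc_prod X) _ _).
Local Notation p := (tan_p (ctc_tan X)).
Local Notation z := (tan_z (ctc_tan X)).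
Local Notation s := (tan_s (ctc_tan X)).
Local Notation l := (tan_l (ctc_tan X)).
Local Notation c := (tan_c (ctc_tan X)).

Definition cross (A B A' B' : X) (f : hom A A') (g : hom B B') :
    hom (A ** B) (A' ** B') :=
  ⟨π1 ;; f, π2 ;; g⟩.

Definition assoc (A B C : X) : hom ((A ** B) ** C) (A ** (B ** C)) :=
  ⟨π1 ;; π1, ⟨π1 ;; π2, π2⟩⟩.

(* The identifications 1 = T 1 and T A x T B = T (A x B). *)
Definition Tone : hom 1 (T 1) := Fone (ctc_pres X).
Definition Tprod (A B : X) : hom (T A ** T B) (T (A ** B)) :=
  Fprod (ctc_pres X) A B.

(* With the identification of T (A' x B') understood, f x g. *)
Definition Tcross (A B A' B' : X) (f : hom A (T A')) (g : hom B (T B')) :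
    hom (A ** B) (T (A' ** B')) :=
  cross f g ;; Tprod A' B'.

Definition admits_negatives (M : X) : Prop :=
  exists n : hom (T M) (T M), n ;; p M = p M /\
  exists h : hom (T M) (tan2 (ctc_tan X) M),
    [/\ h ;; tan_pr1 (ctc_tan X) M = idm (T M),
        h ;; tan_pr2 (ctc_tan X) M = n
      & h ;; s M = p M ;; z M].

Record is_monoid (A : X) (e : hom 1 A) (m : hom (A ** A) A) : Prop :=
  IsMonoid {
  monoid_assoc : cross m (idm A) ;; m = assoc A A A ;; cross (idm A) m ;; m;
  monoid_unitl : ⟨! ;; e, idm A⟩ ;; m = idm A;
  monoid_unitr : ⟨idm A, ! ;; e⟩ ;; m = idm A
}.

Record group_object := GroupObject {
  gob :> X;
  ge : hom 1 gob;
  gm : hom (gob ** gob) gob;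
  gi : hom gob gob;
  g_monoid : is_monoid ge gm;
  g_invl : ⟨gi, idm gob⟩ ;; gm = ! ;; ge;
  g_invr : ⟨idm gob, gi⟩ ;; gm = ! ;; ge
}.

Definition is_Lie_group (G : group_object) : Prop :=
  exists (TeG : X) (k : hom TeG (T G)),
    is_tangent_pullback T (p G) (ge G) k (! : hom TeG 1).

Lemma cpair_ext (Z A B : X) (f g : hom Z (A ** B)) :
  f ;; π1 = g ;; π1 -> f ;; π2 = g ;; π2 -> f = g.
Proof. by move=> e1 e2; rewrite (cpair_uniq f) (cpair_uniq g) e1 e2. Qed.

Lemma comp_cpair (Y Z A B : X) (h : hom Y Z) (f : hom Z A) (g : hom Z B) :
  h ;; ⟨f, g⟩ = ⟨h ;; f, h ;; g⟩.
Proof.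
by apply: cpair_ext; rewrite -comp_assoc ?cpair_pi1 ?cpair_pi2.
Qed.

Lemma cpair_cross (Z A B A' B' : X) (u : hom Z A) (v : hom Z B)
    (f : hom A A') (g : hom B B') :
  ⟨u, v⟩ ;; cross f g = ⟨u ;; f, v ;; g⟩.
Proof. by rewrite comp_cpair !comp_assoc cpair_pi1 cpair_pi2. Qed.

Lemma cpair_assoc (Z A B C : X) (u : hom Z A) (v : hom Z B) (w : hom Z C) :
  ⟨⟨u, v⟩, w⟩ ;; assoc A B C = ⟨u, ⟨v, w⟩⟩.
Proof.
by rewrite !comp_cpair !comp_assoc !cpair_pi1 !cpair_pi2.
Qed.

Lemma Tprod_split (A B : X) :
  Tprod A B ;; ⟨fmap T π1, fmap T π2⟩ = idm (T A ** T B).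
Proof. exact: Fprod_split. Qed.

Lemma split_Tprod (A B : X) :
  ⟨fmap T π1, fmap T π2⟩ ;; Tprod A B = idm (T (A ** B)).
Proof. exact: split_Fprod. Qed.

Lemma Tcpair (Z A B : X) (u : hom Z A) (v : hom Z B) :
  ⟨fmap T u, fmap T v⟩ ;; Tprod A B = fmap T ⟨u, v⟩.
Proof.
rewrite -[RHS]comp_idr -(split_Tprod A B) comp_assoc comp_cpair.
by rewrite -!fmap_comp cpair_pi1 cpair_pi2.
Qed.

Lemma Tprod_pi1 (A B : X) : Tprod A B ;; fmap T π1 = π1.
Proof.
rewrite -[fmap T _](cpair_pi1 (ctc_prod X) _ (fmap T π2)).
by rewrite comp_assoc Tprod_split comp_idl.
Qed.

Lemma Tprod_pi2 (A B : X) : Tprod A B ;; fmap T π2 = π2.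
Proof.
rewrite -[fmap T _](cpair_pi2 (ctc_prod X) (fmap T π1)).
by rewrite comp_assoc Tprod_split comp_idl.
Qed.

Definition Tsplit3 (A B C : X) :
    hom (T ((A ** B) ** C)) ((T A ** T B) ** T C) :=
  ⟨⟨fmap T (π1 ;; π1), fmap T (π1 ;; π2)⟩, fmap T π2⟩.

Lemma Tsplit3_epi (A B C Z : X) (f g : hom ((T A ** T B) ** T C) Z) :
  Tsplit3 A B C ;; f = Tsplit3 A B C ;; g -> f = g.
Proof.
move=> e.
have E : cross (Tprod A B) (idm (T C)) ;; Tprod _ _ ;; Tsplit3 A B C = idm _.
  rewrite /Tsplit3 !comp_cpair !fmap_comp !comp_assoc.
  rewrite -!(comp_assoc _ (Tprod _ _)) !Tprod_pi1 !Tprod_pi2.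
  rewrite /cross !cpair_pi1 cpair_pi2 -!comp_assoc Tprod_pi1 Tprod_pi2 comp_idr.
  apply: cpair_ext; rewrite !(cpair_pi1, cpair_pi2) comp_idl //.
  by rewrite -comp_cpair -[RHS]comp_idr; congr (_ ;; _);
    apply: cpair_ext; rewrite !(cpair_pi1, cpair_pi2) comp_idl.
by rewrite -[f]comp_idl -[g]comp_idl -E -!comp_assoc e.
Qed.

Lemma cpair_pi12 (A B C : X) :
  ⟨π1 ;; π1, π1 ;; π2⟩ = π1 :> hom ((A ** B) ** C) (A ** B).
Proof. by apply: cpair_ext; rewrite ?cpair_pi1 ?cpair_pi2. Qed.

Lemma TTpair_ext (Z A B : X) (f g : hom Z (T (T (A ** B)))) :
  f ;; fmap T (fmap T π1) = g ;; fmap T (fmap T π1) ->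
  f ;; fmap T (fmap T π2) = g ;; fmap T (fmap T π2) -> f = g.
Proof.
move=> e1 e2.
have E : ⟨fmap T (fmap T π1), fmap T (fmap T π2)⟩ ;; Tprod _ _ ;;
    fmap T (Tprod A B) = idm (T (T (A ** B))).
  by rewrite Tcpair -fmap_comp split_Tprod fmap_id.
by rewrite -[f]comp_idr -[g]comp_idr -E !comp_assoc !comp_cpair e1 e2.
Qed.

Section TangentGroup.

Variable G : group_object.

Definition tangent_ge := Tone ;; fmap T (ge G).
Definition tangent_gm := Tprod G G ;; fmap T (gm G).

Lemma bang_Te (A : X) : ! ;; tangent_ge = fmap T (! ;; ge G) :> hom (T A) (T G).
Proof.
rewrite fmap_comp /tangent_ge comp_assoc; congr (_ ;; _).
rewrite -[RHS]comp_idr -(bang_Fone (ctc_pres X)) comp_assoc; congr (_ ;; _).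
by rewrite [RHS]bang_uniq.
Qed.

Lemma cpair_Tm (Z : X) (u v : hom Z G) :
  ⟨fmap T u, fmap T v⟩ ;; tangent_gm = fmap T (⟨u, v⟩ ;; gm G).
Proof. by rewrite /tangent_gm comp_assoc Tcpair fmap_comp. Qed.

Lemma tangent_monoid : is_monoid tangent_ge tangent_gm.
Proof.
move: tangent_gm cpair_Tm => m mE; split.
- apply: Tsplit3_epi; rewrite /Tsplit3 !comp_assoc cpair_assoc !cpair_cross.
  rewrite !comp_idr !mE. congr (fmap T _).
  have := monoid_assoc (g_monoid G).
  by rewrite {1}/cross /assoc cpair_cross !comp_idr cpair_pi12.
- rewrite bang_Te -fmap_id mE.
  by rewrite (monoid_unitl (g_monoid G)).
- rewrite bang_Te -fmap_id mE.
  by rewrite (monoid_unitr (g_monoid G)).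
Qed.

Lemma tangent_invl : ⟨fmap T (gi G), idm (T G)⟩ ;; tangent_gm = ! ;; tangent_ge.
Proof. by rewrite bang_Te -fmap_id cpair_Tm g_invl. Qed.

Lemma tangent_invr : ⟨idm (T G), fmap T (gi G)⟩ ;; tangent_gm = ! ;; tangent_ge.
Proof. by rewrite bang_Te -fmap_id cpair_Tm g_invr. Qed.

Definition tangent_group : group_object :=
  GroupObject tangent_monoid tangent_invl tangent_invr.

End TangentGroup.

(* The group object T^n G; its carrier is convertible to [iter n T G]. *)
Fixpoint iter_tangent_group (n : nat) (G : group_object) : group_object :=
  if n is m.+1 then tangent_group (iter_tangent_group m G) else G.

(* A-parametrized left-invariant vector fields: elements of g(A). *)
Record PLIVF (G : group_object) (A : X) := MkPLIVF {
  plivf :> hom (G ** A) (T G);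
  plivf_over : plivf ;; p G = π1;
  plivf_invariant :
    cross (gm G) (idm A) ;; plivf =
    assoc G G A ;; Tcross (z G) plivf ;; fmap T (gm G)
}.

Section LieFunctor.

Variable G : group_object.

Lemma Lie_map_over (A B : X) (f : hom A B) (x : PLIVF G B) :
  cross (idm G) f ;; x ;; p G = π1.
Proof.
by rewrite -comp_assoc plivf_over /cross cpair_pi1 comp_idr.
Qed.

Lemma Lie_map_invariant (A B : X) (f : hom A B) (x : PLIVF G B) :
  cross (gm G) (idm A) ;; (cross (idm G) f ;; x) =
  assoc G G A ;; Tcross (z G) (cross (idm G) f ;; x) ;; fmap T (gm G).
Proof.
have E1 : cross (gm G) (idm A) ;; cross (idm G) f =
    cross (idm (G ** G)) f ;; cross (gm G) (idm B).
  by rewrite !cpair_cross !comp_idr.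
have E2 : cross (idm (G ** G)) f ;; assoc G G B ;; cross (z G) x =
    assoc G G A ;; cross (z G) (cross (idm G) f ;; x).
  rewrite /cross /assoc.
  rewrite !(comp_assoc, comp_cpair, cpair_pi1, cpair_pi2, comp_idr, comp_idl).
  by [].
rewrite comp_assoc E1 -comp_assoc plivf_invariant /Tcross.
by rewrite !comp_assoc E2.
Qed.

Definition Lie_map (A B : X) (f : hom A B) (x : PLIVF G B) : PLIVF G A :=
  MkPLIVF (Lie_map_over f x) (Lie_map_invariant f x).

Lemma c_Tp (M : X) : c M ;; fmap T (p M) = p (T M).
Proof.
by have := abm_over (tan_c_additive (ctc_tan X) M); rewrite comp_idr.
Qed.

Lemma Tz_c (M : X) : fmap T (z M) ;; c M = z (T M).
Proof.
have := abm_zero (tan_c_additive (ctc_tan X) M); rewrite comp_idl /= => <-.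
by rewrite -comp_assoc tan_cc comp_idr.
Qed.

Lemma Tprod_c (A B : X) :
  fmap T (Tprod A B) ;; c (A ** B) =
  ⟨fmap T π1 ;; c A, fmap T π2 ;; c B⟩ ;; Tprod _ _ ;; fmap T (Tprod A B).
Proof.
apply: TTpair_ext; rewrite -!comp_assoc -fmap_comp ?Tprod_pi1 ?Tprod_pi2.
- by rewrite cpair_pi1 -tan_c_nat comp_assoc -fmap_comp Tprod_pi1.
- by rewrite cpair_pi2 -tan_c_nat comp_assoc -fmap_comp Tprod_pi2.
Qed.

Definition tau_map (A : X) (x : PLIVF G A) : hom (T G ** T A) (T (T G)) :=
  Tprod G A ;; fmap T x ;; c G.

Lemma tau_over (A : X) (x : PLIVF G A) : tau_map x ;; p (T G) = π1.
Proof.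
rewrite /tau_map -c_Tp -!comp_assoc [c G ;; _]comp_assoc tan_cc comp_idl.
by rewrite -fmap_comp plivf_over Tprod_pi1.
Qed.

Lemma tau_invariant (A : X) (x : PLIVF G A) :
  cross (tangent_gm G) (idm (T A)) ;; tau_map x =
  assoc (T G) (T G) (T A) ;; Tcross (z (T G)) (tau_map x) ;;
    fmap T (tangent_gm G).
Proof.
have E (Z : X) (u : hom Z G) (v : hom Z A) :
    ⟨fmap T u, fmap T v⟩ ;; tau_map x = fmap T (⟨u, v⟩ ;; x) ;; c G.
  by rewrite /tau_map !comp_assoc Tcpair fmap_comp.
move: (tau_map x) E => t E.
apply: Tsplit3_epi; rewrite /Tsplit3 /Tcross !comp_assoc cpair_assoc.
rewrite !cpair_cross cpair_Tm comp_idr !E cpair_pi12.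
have := plivf_invariant x; rewrite {1}/cross comp_idr => ->.
rewrite /Tcross comp_assoc {1}/assoc cpair_cross -Tz_c fmap_comp -comp_assoc.
rewrite tan_c_nat [fmap T (tangent_gm G)]fmap_comp !comp_assoc; congr (_ ;; _).
rewrite fmap_comp -comp_assoc Tprod_c !comp_assoc; congr (_ ;; _ ;; _).
rewrite comp_cpair !comp_assoc -!fmap_comp cpair_pi1 cpair_pi2.
by rewrite fmap_comp.
Qed.

Definition tau (A : X) (x : PLIVF G A) : PLIVF (tangent_group G) (T A) :=
  @MkPLIVF (tangent_group G) (T A) (tau_map x) (tau_over x) (tau_invariant x).

End LieFunctor.

(* A representation of the Lie functor of G by the object [R]. *)
Record representation (G : group_object) (R : X) := Representation {
  rep : forall A, PLIVF G A -> hom A R;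
  rep_inv : forall A, hom A R -> PLIVF G A;
  repK : forall A, cancel (@rep A) (@rep_inv A);
  rep_invK : forall A, cancel (@rep_inv A) (@rep A);
  rep_nat : forall (A B : X) (f : hom A B) (x : PLIVF G B),
    rep (Lie_map f x) = f ;; rep x
}.

Definition tangently_representable (G : group_object) : Prop :=
  exists (R : X)
    (φ : forall n, representation (iter_tangent_group n G) (iter n T R)),
  forall n (A : X) (x : PLIVF (iter_tangent_group n G) A),
    rep (φ n.+1) (tau x) = fmap T (rep (φ n) x).

Record diff_object := DiffObject {
  dob :> X;
  dzero : hom 1 dob;
  dadd : hom (dob ** dob) dob;
  d_monoid : is_monoid dzero dadd;
  d_comm : ⟨π2, π1⟩ ;; dadd = dadd;
  dphat : hom (T dob) dob;
  d_z_phat : z dob ;; dphat = ! ;; dzero;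
  d_s_phat : s dob ;; dphat =
    ⟨tan_pr1 (ctc_tan X) dob ;; dphat, tan_pr2 (ctc_tan X) dob ;; dphat⟩ ;; dadd;
  d_Tzero_phat : Tone ;; fmap T dzero ;; dphat = dzero;
  d_Tadd_phat :
    Tprod dob dob ;; fmap T dadd ;; dphat = cross dphat dphat ;; dadd;
  d_l_phat : l dob ;; fmap T dphat ;; dphat = dphat;
  (* The inverse of <p, phat>. *)
  djoin : hom (dob ** dob) (T dob);
  d_splitK : ⟨p dob, dphat⟩ ;; djoin = idm (T dob);
  d_joinK : djoin ;; ⟨p dob, dphat⟩ = idm (dob ** dob)
}.

(* The unique map with the two properties below. *)
Definition vertical_lift (A : diff_object) : hom A (T A) :=
  ⟨! ;; dzero A, idm A⟩ ;; djoin A.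

Lemma vertical_lift_p (A : diff_object) :
  vertical_lift A ;; p A = ! ;; dzero A.
Proof.
rewrite -[p A](cpair_pi1 (ctc_prod X) _ (dphat A)) /vertical_lift.
by rewrite -comp_assoc [djoin A ;; _]comp_assoc d_joinK comp_idl cpair_pi1.
Qed.

Lemma vertical_lift_phat (A : diff_object) :
  vertical_lift A ;; dphat A = idm A.
Proof.
rewrite -[dphat A](cpair_pi2 (ctc_prod X) (p A)) /vertical_lift.
by rewrite -comp_assoc [djoin A ;; _]comp_assoc d_joinK comp_idl cpair_pi2.
Qed.

(* A_1 x (A_2 x ... (A_n x 1)); the final factor 1 makes the empty list
   uniform with the others. *)
Fixpoint dprod (As : seq diff_object) : X :=
  if As is A :: As' then A ** dprod As' else 1.

(* z x ... x lambda x ... x z with lambda at index [k], counted from 0; only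
   meant for [k < size As].  By naturality, [z (dprod As')] is the product of
   the maps z of the factors. *)
Fixpoint dprod_lift (As : seq diff_object) (k : nat) :
    hom (dprod As) (T (dprod As)) :=
  match As return hom (dprod As) (T (dprod As)) with
  | [::] => z 1
  | A :: As' =>
    match k with
    | 0 => Tcross (vertical_lift A) (z (dprod As'))
    | k'.+1 => Tcross (z A) (dprod_lift As' k')
    end
  end.

Definition multilinear (As : seq diff_object) (B : diff_object)
    (f : hom (dprod As) B) : Prop :=
  forall k, k < size As -> dprod_lift As k ;; fmap T f = f ;; vertical_lift B.

Definition multilinear_PLIVF (G : group_object) (As : seq diff_object)
    (x : PLIVF G (dprod As)) : Prop :=
  forall k, k < size As -> Tcross (z G) (dprod_lift As k) ;; fmap T x = x ;; l G.

Definition differentiably_representable (G : group_object) : Prop :=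
  exists (D : diff_object) (φ : representation G D),
  forall As : seq diff_object,
    (forall x : PLIVF G (dprod As),
       multilinear_PLIVF x -> multilinear (rep φ x)) /\
    (forall f : hom (dprod As) D,
       multilinear f -> multilinear_PLIVF (rep_inv φ f)).

Definition parallelizable (M : X) : Prop :=
  exists (D : diff_object) (ν : hom (T M) (M ** D)),
    is_iso ν /\ ν ;; Tcross (z M) (vertical_lift D) = l M ;; fmap T ν.

End CartesianTangent.

(* Main.v *)
(** The tangent bundle T G of a group object is a group object, and p, z, l, c
are group homomorphisms.  By Eckmann-Hilton, fibrewise addition restricted to
the kernel R of p_G is multiplication in T G, so that R is a commutative group,
and T G is the semidirect product of G and R through v = z(p v) . w.  Evaluation
at the unit identifies left-invariant vector fields with maps into R, and
negatives exist in every group object.  Universality of the vertical lift says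
that the kernel T R of T p_G consists of the products z(u) . l(v) with u, v in R;
the second component is the structure map of the differential object R, and its
axioms become identities between such products. *)

Require Import Defs.
From mathcomp Require Import all_boot.
From mathcomp Require Import boolp.

Set Implicit Arguments.
Unset Strict Implicit.
Unset Printing Implicit Defensive.

Section LieGroups.

Variable X : cartesian_tangent_category.

Local Notation T := (tan (ctc_tan X)).
Local Notation T2 := (tan2 (ctc_tan X)).
Local Notation "A ** B" := (cprod (ctc_prod X) A B)
  (at level 40, left associativity).
Local Notation "⟨ f , g ⟩" := (cpair (ctc_prod X) f g) (at level 0).
Local Notation "𝟙" := (Defs.one (ctc_prod X)).
Local Notation "!" := (bang (ctc_prod X) _) (at level 0).
Local Notation π1 := (pi1 (ctc_prod X) _ _).
Local Notation π2 := (pi2 (ctc_prod X) _ _).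
Local Notation p := (tan_p (ctc_tan X)).
Local Notation z := (tan_z (ctc_tan X)).
Local Notation s := (tan_s (ctc_tan X)).
Local Notation l := (tan_l (ctc_tan X)).
Local Notation c := (tan_c (ctc_tan X)).
Local Notation pr1 := (tan_pr1 (ctc_tan X)).
Local Notation pr2 := (tan_pr2 (ctc_tan X)).

Implicit Types (A B M N Z : X) (G H K : group_object X).

(** * Cartesian tangent categories *)

Lemma Tpair_ext Z A B (f g : hom Z (T (A ** B))) :
  f ;; fmap T π1 = g ;; fmap T π1 -> f ;; fmap T π2 = g ;; fmap T π2 -> f = g.
Proof.
move=> e1 e2; rewrite -[f]comp_idr -[g]comp_idr -(split_Tprod A B).
by rewrite !comp_assoc !comp_cpair e1 e2.
Qed.

Lemma cpair_Tprod1 Z A B (u : hom Z (T A)) (v : hom Z (T B)) :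
  ⟨u, v⟩ ;; Tprod A B ;; fmap T π1 = u.
Proof. by rewrite -comp_assoc Tprod_pi1 cpair_pi1. Qed.

Lemma cpair_Tprod2 Z A B (u : hom Z (T A)) (v : hom Z (T B)) :
  ⟨u, v⟩ ;; Tprod A B ;; fmap T π2 = v.
Proof. by rewrite -comp_assoc Tprod_pi2 cpair_pi2. Qed.

Lemma bang_one Z (f g : hom Z 𝟙) : f = g.
Proof. by rewrite (bang_uniq f) (bang_uniq g). Qed.

Lemma zp M : z M ;; p M = idm M.
Proof. exact: ab_zero_over (tan_additive (ctc_tan X) M). Qed.

Lemma l_Tp M : l M ;; fmap T (p M) = p M ;; z M.
Proof. exact: abm_over (tan_l_additive (ctc_tan X) M). Qed.

Lemma z_l M : z M ;; l M = z M ;; z (T M).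
Proof.
by rewrite tan_z_nat; apply: abm_zero (tan_l_additive (ctc_tan X) M).
Qed.

Lemma c_p M : c M ;; p (T M) = fmap T (p M).
Proof. by rewrite -c_Tp comp_assoc tan_cc comp_idl. Qed.

Lemma comp_cc M Z (a : hom Z (T (T M))) : a ;; c M ;; c M = a.
Proof. by rewrite -comp_assoc tan_cc comp_idr. Qed.

Lemma c_iso M : is_iso (c M).
Proof. by exists (c M); rewrite tan_cc. Qed.

Lemma l_p M : l M ;; p (T M) = p M ;; z M.
Proof. by rewrite -[l M]tan_lc -comp_assoc c_p l_Tp. Qed.

(** * Generalized elements of group objects *)

(** Lets unification find the group structure on [T H], so that products of maps into [T H] can be
    written without naming it. *)
Canonical tangent_group.

(** Each [hom Z H] is a group, naturally in Z; group diagrams become equations between generalized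
    elements. *)
Definition gmul H Z (u v : hom Z H) : hom Z H := ⟨u, v⟩ ;; gm H.
Definition gone H Z : hom Z H := ! ;; ge H.
Definition ginv H Z (u : hom Z H) : hom Z H := u ;; gi H.

Local Notation "u ∙ v" := (gmul u v) (at level 48, left associativity).

Section Group.

Variables (H : group_object X) (Z : X).
Implicit Types u v w : hom Z H.

Lemma comp_gmul Y (f : hom Y Z) u v : f ;; (u ∙ v) = (f ;; u) ∙ (f ;; v).
Proof. by rewrite /gmul comp_assoc comp_cpair. Qed.

Lemma comp_gone Y (f : hom Y Z) : f ;; gone H Z = gone H Y.
Proof. by rewrite /gone comp_assoc (bang_one (f ;; !) !). Qed.

Lemma gmulA u v w : u ∙ (v ∙ w) = u ∙ v ∙ w.
Proof.
have := congr1 (Defs.comp ⟨⟨u, v⟩, w⟩) (monoid_assoc (g_monoid H)).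
by rewrite !comp_assoc cpair_assoc !cpair_cross !comp_idr.
Qed.

Lemma gmul1l u : gone H Z ∙ u = u.
Proof.
have := congr1 (Defs.comp u) (monoid_unitl (g_monoid H)).
by rewrite comp_assoc comp_cpair !comp_idr comp_assoc (bang_one (u ;; !) !).
Qed.

Lemma gmul1r u : u ∙ gone H Z = u.
Proof.
have := congr1 (Defs.comp u) (monoid_unitr (g_monoid H)).
by rewrite comp_assoc comp_cpair !comp_idr comp_assoc (bang_one (u ;; !) !).
Qed.

Lemma gmulVl u : ginv u ∙ u = gone H Z.
Proof.
have := congr1 (Defs.comp u) (g_invl H).
by rewrite !comp_assoc comp_cpair !comp_idr (bang_one (u ;; !) !).
Qed.

Lemma gmulVr u : u ∙ ginv u = gone H Z.
Proof.
have := congr1 (Defs.comp u) (g_invr H).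
by rewrite !comp_assoc comp_cpair !comp_idr (bang_one (u ;; !) !).
Qed.

Lemma gmulKl u v : ginv u ∙ (u ∙ v) = v.
Proof. by rewrite gmulA gmulVl gmul1l. Qed.

Lemma gmulVKl u v : u ∙ (ginv u ∙ v) = v.
Proof. by rewrite gmulA gmulVr gmul1l. Qed.

Lemma gmulI u v w : u ∙ v = u ∙ w -> v = w.
Proof. by move=> e; rewrite -(gmulKl u v) e gmulKl. Qed.

End Group.

(** * Structure maps as group homomorphisms *)

Definition group_hom H K (f : hom H K) : Prop :=
  forall Z (u v : hom Z H), u ∙ v ;; f = (u ;; f) ∙ (v ;; f).

Section GroupHom.

Variables (H K : group_object X) (f : hom H K).
Hypothesis f_hom : group_hom f.

Lemma group_hom1 Z : gone H Z ;; f = gone K Z.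
Proof.
apply: (gmulI (u := gone H Z ;; f)).
by rewrite -f_hom gmul1l gmul1r.
Qed.

Lemma group_homV Z (u : hom Z H) : ginv u ;; f = ginv (u ;; f).
Proof.
apply: (gmulI (u := u ;; f)).
by rewrite -f_hom !gmulVr group_hom1.
Qed.

End GroupHom.

(** Naturality of [z] at [gm H]; what remains is compatibility of [z] with [Tprod], checked on the
    two projections. *)
Lemma gmul_z H : group_hom (z H : hom H (T H)).
Proof.
move=> Z u v; rewrite /gmul -comp_assoc tan_z_nat /= /tangent_gm !comp_assoc.
congr (_ ;; _); apply: Tpair_ext.
- by rewrite cpair_Tprod1 -comp_assoc -tan_z_nat comp_assoc cpair_pi1.
- by rewrite cpair_Tprod2 -comp_assoc -tan_z_nat comp_assoc cpair_pi2.
Qed.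

Lemma gmul_p H : group_hom (p H : hom (T H) H).
Proof.
move=> Z u v; rewrite /gmul /= /tangent_gm -!comp_assoc tan_p_nat !comp_assoc.
congr (_ ;; _); apply: cpair_ext.
- by rewrite cpair_pi1 -comp_assoc -tan_p_nat comp_assoc cpair_Tprod1.
- by rewrite cpair_pi2 -comp_assoc -tan_p_nat comp_assoc cpair_Tprod2.
Qed.

Lemma TTcpair1 Z A B (u : hom Z (T (T A))) (v : hom Z (T (T B))) :
  ⟨u, v⟩ ;; Tprod _ _ ;; fmap T (Tprod A B) ;; fmap T (fmap T π1) = u.
Proof. by rewrite -comp_assoc -fmap_comp Tprod_pi1 cpair_Tprod1. Qed.

Lemma TTcpair2 Z A B (u : hom Z (T (T A))) (v : hom Z (T (T B))) :
  ⟨u, v⟩ ;; Tprod _ _ ;; fmap T (Tprod A B) ;; fmap T (fmap T π2) = v.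
Proof. by rewrite -comp_assoc -fmap_comp Tprod_pi2 cpair_Tprod2. Qed.

Lemma gmul_l H : group_hom (l H : hom (T H) (T (T H))).
Proof.
move=> Z u v; rewrite /gmul /= /tangent_gm fmap_comp.
rewrite -comp_assoc -[Tprod H H ;; _ ;; _]comp_assoc tan_l_nat !comp_assoc.
congr (_ ;; _); apply: TTpair_ext.
- by rewrite TTcpair1 -comp_assoc -tan_l_nat comp_assoc cpair_Tprod1.
- by rewrite TTcpair2 -comp_assoc -tan_l_nat comp_assoc cpair_Tprod2.
Qed.

Lemma gmul_c H : group_hom (c H : hom (T (T H)) (T (T H))).
Proof.
move=> Z u v; rewrite /gmul /= /tangent_gm fmap_comp.
rewrite -!comp_assoc tan_c_nat !comp_assoc.
congr (_ ;; _); apply: TTpair_ext.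
- by rewrite TTcpair1 -comp_assoc -tan_c_nat comp_assoc TTcpair1.
- by rewrite TTcpair2 -comp_assoc -tan_c_nat comp_assoc TTcpair2.
Qed.

Lemma fmap_gmul H Z (u v : hom Z H) :
  fmap T (u ∙ v) = fmap T u ∙ fmap T v.
Proof. by rewrite /gmul cpair_Tm. Qed.

Lemma gmul_fmap H K (f : hom H K) :
  group_hom f -> @group_hom (tangent_group H) (tangent_group K) (fmap T f).
Proof.
move=> f_hom Z u v.
(* The law of [f] at the universal pair of projections is a single equation between maps on H x H,
   to which [T] applies. *)
have e : fmap T (gm H) ;; fmap T f =
    fmap T ((π1 ;; f : hom (H ** H) K) ∙ (π2 ;; f)).
  rewrite -fmap_comp -f_hom /gmul -[in LHS](comp_idl (gm H)).
  congr (fmap T (_ ;; _ ;; _)).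
  by apply: cpair_ext; rewrite ?cpair_pi1 ?cpair_pi2 comp_idl.
rewrite /gmul /= /tangent_gm -!comp_assoc e.
rewrite fmap_gmul !comp_gmul !fmap_comp !comp_assoc.
by rewrite cpair_Tprod1 cpair_Tprod2 -comp_assoc.
Qed.

Lemma fmap_gone H Z : fmap T (gone H Z) = gone (tangent_group H) (T Z).
Proof. by rewrite /gone bang_Te. Qed.

Lemma gone_z H Z : gone H Z ;; z H = gone (tangent_group H) Z.
Proof. exact: group_hom1 (@gmul_z H) Z. Qed.

Lemma gone_p H Z : gone (tangent_group H) Z ;; p H = gone H Z.
Proof. exact: group_hom1 (@gmul_p H) Z. Qed.

Lemma gone_l H Z :
  gone (tangent_group H) Z ;; l H = gone (tangent_group (tangent_group H)) Z.
Proof. exact: group_hom1 (@gmul_l H) Z. Qed.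

(** * Fibrewise addition in tangent groups *)

(* A relation, since pairings into T_2 M are only given by unique existence. *)
Definition tsum M Z (u v w : hom Z (T M)) : Prop :=
  exists h : hom Z (T2 M), [/\ h ;; pr1 M = u, h ;; pr2 M = v & h ;; s M = w].

Lemma T2_pair M Z (u v : hom Z (T M)) : u ;; p M = v ;; p M ->
  exists h : hom Z (T2 M), h ;; pr1 M = u /\ h ;; pr2 M = v.
Proof.
move=> e; have [h [hP _]] := proj2 (tan2_pullback (ctc_tan X) M 0) _ _ _ e.
by exists h.
Qed.

Lemma T2_over M : pr1 M ;; p M = pr2 M ;; p M.
Proof. exact: proj1 (tan2_pullback (ctc_tan X) M 0). Qed.

Lemma T2_ext M Z (h k : hom Z (T2 M)) :
  h ;; pr1 M = k ;; pr1 M -> h ;; pr2 M = k ;; pr2 M -> h = k.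
Proof.
move=> e1 e2.
have e : h ;; pr1 M ;; p M = h ;; pr2 M ;; p M by rewrite -!comp_assoc T2_over.
have [j [_ jU]] := proj2 (tan2_pullback (ctc_tan X) M 0) _ _ _ e.
by rewrite -(jU h) // -(jU k).
Qed.

Lemma TT2_pair M Z (u v : hom Z (T (T M))) :
  u ;; fmap T (p M) = v ;; fmap T (p M) ->
  exists h : hom Z (T (T2 M)),
    h ;; fmap T (pr1 M) = u /\ h ;; fmap T (pr2 M) = v.
Proof.
move=> e; have [h [hP _]] := proj2 (tan2_pullback (ctc_tan X) M 1) _ _ _ e.
by exists h.
Qed.

Lemma TT2_ext M Z (h k : hom Z (T (T2 M))) :
  h ;; fmap T (pr1 M) = k ;; fmap T (pr1 M) ->
  h ;; fmap T (pr2 M) = k ;; fmap T (pr2 M) -> h = k.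
Proof.
move=> e1 e2.
have e : h ;; fmap T (pr1 M) ;; fmap T (p M) =
    h ;; fmap T (pr2 M) ;; fmap T (p M).
  by rewrite -!comp_assoc -!fmap_comp T2_over.
have [j [_ jU]] := proj2 (tan2_pullback (ctc_tan X) M 1) _ _ _ e.
by rewrite -(jU h) // -(jU k).
Qed.

Section Tsum.

Variables (M Z : X).
Implicit Types u v w : hom Z (T M).

Lemma tsum_ex u v : u ;; p M = v ;; p M -> exists w, tsum u v w.
Proof.
by move=> /T2_pair[h [h1 h2]]; exists (h ;; s M); exists h.
Qed.

Lemma tsum_fun u v w w' : tsum u v w -> tsum u v w' -> w = w'.
Proof.
move=> [h [h1 h2 <-]] [k [k1 k2 <-]].
by rewrite (@T2_ext _ _ h k) ?h1 ?h2.
Qed.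

Lemma tsum0r u : tsum u (u ;; p M ;; z M) u.
Proof.
have [|h [h1 h2]] := @T2_pair M Z u (u ;; p M ;; z M).
  by rewrite -!comp_assoc zp comp_idr.
exists h; split=> //.
by rewrite (ab_add0 (tan_additive (ctc_tan X) M)) /= ?h1 // h2 h1.
Qed.

Lemma tsumC u v w : tsum u v w -> tsum v u w.
Proof.
move=> [h [h1 h2 <-]]; have [|k [k1 k2]] := @T2_pair M Z v u.
  by rewrite -h1 -h2 -!comp_assoc T2_over.
exists k; split=> //.
by apply: (ab_addC (tan_additive (ctc_tan X) M)); rewrite /= ?k1 ?k2 ?h1 ?h2.
Qed.

Lemma tsum0l u : tsum (u ;; p M ;; z M) u u.
Proof. exact/tsumC/tsum0r. Qed.

Lemma tsum_fmap N (f : hom M N) u v w :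
  tsum u v w -> tsum (u ;; fmap T f) (v ;; fmap T f) (w ;; fmap T f).
Proof.
move=> [h [h1 h2 <-]].
have [|f2 [e1 e2]] :=
    @T2_pair N (T2 M) (pr1 M ;; fmap T f) (pr2 M ;; fmap T f).
  by rewrite -!comp_assoc !tan_p_nat !comp_assoc T2_over.
exists (h ;; f2); split; rewrite -!comp_assoc.
- by rewrite e1 comp_assoc h1.
- by rewrite e2 comp_assoc h2.
- by rewrite (tan_s_nat e1 e2).
Qed.

End Tsum.

(** Naturality of [s] at the two projections determines the components of the sum. *)
Lemma tsum_pair Z A B (u v w : hom Z (T A)) (u' v' w' : hom Z (T B)) :
  tsum u v w -> tsum u' v' w' ->
  tsum (⟨u, u'⟩ ;; Tprod A B) (⟨v, v'⟩ ;; Tprod A B) (⟨w, w'⟩ ;; Tprod A B).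
Proof.
move=> S S'.
have pE (a : hom Z (T A)) (b : hom Z (T B)) :
    ⟨a, b⟩ ;; Tprod A B ;; p (A ** B) = ⟨a ;; p A, b ;; p B⟩.
  apply: cpair_ext; rewrite -comp_assoc -tan_p_nat comp_assoc.
  - by rewrite cpair_Tprod1 cpair_pi1.
  - by rewrite cpair_Tprod2 cpair_pi2.
have over M (a b d : hom Z (T M)) : tsum a b d -> a ;; p M = b ;; p M.
  by move=> [h [<- <- _]]; rewrite -!comp_assoc T2_over.
have [|t tS] := @tsum_ex _ _ (⟨u, u'⟩ ;; Tprod A B) (⟨v, v'⟩ ;; Tprod A B).
  by rewrite !pE (over _ _ _ _ S) (over _ _ _ _ S').
suff <- : t = ⟨w, w'⟩ ;; Tprod A B by [].
apply: Tpair_ext.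
- move: (tsum_fmap π1 tS); rewrite !cpair_Tprod1 => S1; exact: tsum_fun S1 S.
- move: (tsum_fmap π2 tS); rewrite !cpair_Tprod2 => S2; exact: tsum_fun S2 S'.
Qed.

(** Naturality of [s] at the multiplication: the interchange law of Eckmann-Hilton. *)
Lemma tsum_gmul H Z (u v w u' v' w' : hom Z (T H)) :
  tsum u v w -> tsum u' v' w' -> tsum (u ∙ u') (v ∙ v') (w ∙ w').
Proof.
move=> S S'; have := tsum_fmap (gm H) (tsum_pair S S').
by rewrite /gmul /= /tangent_gm !comp_assoc.
Qed.

(* Eckmann-Hilton: u = u . e and v = e . v, and sums commute with products. *)
Lemma tsum_kernel H Z (u v : hom Z (T H)) :
  u ;; p H = gone H Z -> v ;; p H = gone H Z -> tsum u v (u ∙ v).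
Proof.
move=> eu ev; have := tsum_gmul (tsum0r u) (tsum0l v).
by rewrite eu ev !gone_z gmul1l gmul1r.
Qed.

(** With u = 0 + u and v = v + 0, interchange makes u . v the sum of v and u, which is v . u by
    [tsum_kernel]. *)
Lemma gmulC_kernel H Z (u v : hom Z (T H)) :
  u ;; p H = gone H Z -> v ;; p H = gone H Z -> u ∙ v = v ∙ u.
Proof.
move=> eu ev; have := tsum_gmul (tsum0l u) (tsum0r v).
rewrite eu ev !gone_z gmul1l gmul1r => S.
exact: tsum_fun S (tsum_kernel ev eu).
Qed.

(** The flip is an involutive homomorphism carrying the kernel of [T p] to the kernel of [p], where
    products commute. *)
Lemma gmulC_Tkernel H Z (u v : hom Z (T (T H))) :
  u ;; fmap T (p H) = gone (tangent_group H) Z ->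
  v ;; fmap T (p H) = gone (tangent_group H) Z -> u ∙ v = v ∙ u.
Proof.
move=> eu ev.
rewrite -[LHS]comp_cc -[RHS]comp_cc; congr (_ ;; _); rewrite !gmul_c.
by apply: gmulC_kernel; rewrite -comp_assoc c_p.
Qed.

(* The negative of v, lying over g, is z(g) . v^-1 . z(g). *)
Lemma group_negatives H : admits_negatives H.
Proof.
pose i : hom (T H) (T H) := idm (T H); pose b := p H ;; z H.
have bp : b ;; p H = p H by rewrite -comp_assoc zp comp_idr.
have ip : i ;; p H = p H by rewrite comp_idl.
exists (b ∙ (ginv i ∙ b)); split.
  rewrite !gmul_p (group_homV (@gmul_p H)) bp ip.
  by rewrite gmulA gmulVr gmul1l.
(* The trivial sums v + 0 over g and 0 + v^-1 z(g) over the unit multiply to v + z(g) v^-1 z(g) = v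
   v^-1 z(g) = z(g). *)
have S1 : tsum i b i by have := tsum0r i; rewrite ip.
have S2 : tsum (gone _ (T H)) (ginv i ∙ b) (ginv i ∙ b).
  have := tsum0l (ginv i ∙ b).
  by rewrite gmul_p (group_homV (@gmul_p H)) bp ip gmulVl gone_z.
have := tsum_gmul S1 S2; rewrite gmul1r => -[h [h1 h2 h3]].
by exists h; split=> //; rewrite h3 gmulA gmulVr gmul1l.
Qed.

(* The canonical flip c carries [tsum_kernel] from the bundle p_T to T p. *)
Lemma Tsum_kernel H Z (h : hom Z (T (T2 H))) (u v : hom Z (T (T H))) :
  h ;; fmap T (pr1 H) = u -> h ;; fmap T (pr2 H) = v ->
  u ;; fmap T (p H) = gone (tangent_group H) Z ->
  v ;; fmap T (p H) = gone (tangent_group H) Z -> h ;; fmap T (s H) = u ∙ v.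
Proof.
move=> h1 h2 eu ev.
have [j [j1 j2 j3]] : tsum (u ;; c H) (v ;; c H) ((u ;; c H) ∙ (v ;; c H)).
  by apply: tsum_kernel; rewrite -comp_assoc c_p.
have [|t [t1 t2]] := @TT2_pair H _ (pr1 (T H) ;; c H) (pr2 (T H) ;; c H).
  by rewrite -!comp_assoc c_Tp T2_over.
have st := abm_add (tan_c_additive (ctc_tan X) H) t1 t2.
have -> : h = j ;; t.
  apply: TT2_ext; rewrite ?h1 ?h2 -comp_assoc.
  - by rewrite t1 comp_assoc j1 comp_cc.
  - by rewrite t2 comp_assoc j2 comp_cc.
by rewrite -comp_assoc -st comp_assoc j3 -gmul_c comp_cc.
Qed.

(** * Universality of the vertical lift *)

Lemma vertical_pair M : exists h : hom (T2 M) (T (T2 M)),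
  [/\ h ;; fmap T (pr1 M) = pr1 M ;; z (T M),
      h ;; fmap T (pr2 M) = pr2 M ;; l M
    & is_pullback (fmap T (p M)) (z M) (h ;; fmap T (s M)) (pr1 M ;; p M)].
Proof.
have [|h [h1 h2]] := @TT2_pair M _ (pr1 M ;; z (T M)) (pr2 M ;; l M).
  by rewrite -!comp_assoc l_Tp -tan_z_nat !comp_assoc T2_over.
by exists h; split=> //; apply: tan_universal.
Qed.

(** A vector w gives the pair (0, w), which xi sends to l(w). By universality xi and the base point
    are jointly monic, and l(w) determines the base point of w because [z] is split by [p]. *)
Lemma l_mono M Z (u v : hom Z (T M)) : u ;; l M = v ;; l M -> u = v.
Proof.
move=> e; have [h [h1 h2 [_ hU]]] := vertical_pair M.
have e' : u ;; p M ;; z M = v ;; p M ;; z M.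
  by rewrite -!comp_assoc -l_Tp !comp_assoc e.
have ep : u ;; p M = v ;; p M.
  by rewrite -[LHS]comp_idr -[RHS]comp_idr -zp !comp_assoc e'.
have [i [i1 i2 i3]] := tsum0l (idm (T M)).
have key (w : hom Z (T M)) : exists2 j : hom Z (T2 M), j ;; pr2 M = w &
    j ;; (h ;; fmap T (s M)) = w ;; l M /\ j ;; (pr1 M ;; p M) = w ;; p M.
  exists (w ;; i); first by rewrite -comp_assoc i2 comp_idr.
  split; last first.
    rewrite !comp_assoc -(comp_assoc w) i1 comp_idl.
    by rewrite -!comp_assoc zp comp_idr.
  (* z x l sends (0, w) to l(w) pushed along [fmap T i], and the two components of [i] add up to the
     identity. *)
  have -> : w ;; i ;; (h ;; fmap T (s M)) = w ;; i ;; h ;; fmap T (s M).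
    by rewrite !comp_assoc.
  have -> : w ;; i ;; h = w ;; l M ;; fmap T i.
    apply: TT2_ext; rewrite -!comp_assoc.
    - rewrite h1 -fmap_comp i1 comp_idl [i ;; _]comp_assoc i1 comp_idl.
      by rewrite fmap_comp [l M ;; _]comp_assoc l_Tp -!comp_assoc tan_z_nat.
    - by rewrite h2 -fmap_comp i2 fmap_id comp_idr [i ;; _]comp_assoc i2
        comp_idl.
  by rewrite -!comp_assoc -fmap_comp i3 fmap_id comp_idr.
have [j ju [j1 j2]] := key u; have [j' jv [j1' j2']] := key v.
have [|t [_ tU]] := hU _ (u ;; l M) (u ;; p M).
  by rewrite -comp_assoc l_Tp comp_assoc.
rewrite -ju -jv -(tU j) ?j1 ?j2 //; congr (_ ;; _); apply: tU.
by rewrite j1' j2' e ep.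
Qed.

(* T need not preserve the pullback that makes l monic; but up to flips, which
   are invertible, T l_M is l_TM. *)
Lemma Tl_mono M Z (u v : hom Z (T (T M))) :
  u ;; fmap T (l M) = v ;; fmap T (l M) -> u = v.
Proof.
have TlE (a : hom Z (T (T M))) :
    a ;; fmap T (l M) ;; c (T M) ;; fmap T (c M) = a ;; c M ;; l (T M).
  rewrite -{1}[a]comp_cc -(comp_assoc _ (c M)) -tan_lcc !comp_assoc.
  rewrite -(comp_assoc _ _ (c (T M))) tan_cc comp_idr.
  by rewrite -(comp_assoc _ _ (fmap T _)) -fmap_comp tan_cc fmap_id comp_idr.
move=> e; rewrite -[u]comp_cc -[v]comp_cc; congr (_ ;; _).
by apply: l_mono; rewrite -!TlE e.
Qed.

(** Universality and [Tsum_kernel] write w as z(u) . l(v). Projecting by [p] kills l(v), so the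
    second hypothesis makes u trivial. *)
Lemma vertical_kernel H Z (w : hom Z (T (T H))) :
  w ;; fmap T (p H) = gone (tangent_group H) Z ->
  w ;; p (T H) = gone (tangent_group H) Z ->
  exists2 v : hom Z (T H), v ;; p H = gone H Z & v ;; l H = w.
Proof.
move=> e1 e2; have [h [h1 h2 [_ hU]]] := vertical_pair H.
have [|j [[j1 j2] _]] := hU _ w (gone H Z); first by rewrite gone_z.
have [u uE] : exists u, u = j ;; pr1 H by exists (j ;; pr1 H).
have [v vE] : exists v, v = j ;; pr2 H by exists (j ;; pr2 H).
have up : u ;; p H = gone H Z by rewrite uE -comp_assoc.
have vp : v ;; p H = gone H Z by rewrite vE -comp_assoc -T2_over.
have wE : w = (u ;; z (T H)) ∙ (v ;; l H).
  rewrite -j1 comp_assoc; apply: Tsum_kernel; rewrite -!comp_assoc.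
  - by rewrite h1 uE comp_assoc.
  - by rewrite h2 vE comp_assoc.
  - by rewrite -tan_z_nat comp_assoc up gone_z.
  - by rewrite l_Tp comp_assoc vp gone_z.
have u1 : u = gone (tangent_group H) Z.
  rewrite -e2 wE (@gmul_p (tangent_group H)) -!comp_assoc zp l_p comp_idr.
  by rewrite comp_assoc vp gone_z gmul1r.
by exists v; rewrite // wE u1 gone_z gmul1l.
Qed.

(** * The tangent space at the unit as a differential object *)

(** The pullback of [p H] along the unit, with its only possible map to the terminal object left
    out. *)
Definition tangent_kernel H (R : X) (k : hom R (T H)) : Prop :=
  k ;; p H = gone H R /\
  forall Z (u : hom Z (T H)), u ;; p H = gone H Z -> exists! h, h ;; k = u.

Lemma tangent_kernel_mono H R (k : hom R (T H)) Z (a b : hom Z R) :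
  tangent_kernel k -> a ;; k = b ;; k -> a = b.
Proof.
move=> [k1 kU] e; have [|h [_ hU]] := kU _ (a ;; k).
  by rewrite -comp_assoc k1 comp_gone.
by rewrite -(hU a) // -(hU b).
Qed.

Lemma tangent_kernel_lift H R (k : hom R (T H)) Z (u : hom Z (T H)) :
  tangent_kernel k -> u ;; p H = gone H Z -> exists h, h ;; k = u.
Proof. by move=> [_ kU] /kU[h [hP _]]; exists h. Qed.

Section DiffObject.

Variables (G : group_object X) (R : X) (k : hom R (T G)).
(** The second hypothesis expresses that [T] preserves the first kernel: the flip turns a kernel of
    [fmap T (p G)] into a kernel of [p] for the group [T G]. *)
Hypotheses (kk : tangent_kernel k)
  (Tkk : @tangent_kernel (tangent_group G) (T R) (fmap T k ;; c G)).

Lemma kernel_over Z (a : hom Z R) : a ;; k ;; p G = gone G Z.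
Proof. by rewrite -comp_assoc kk.1 comp_gone. Qed.

Lemma Tkernel_mono Z (a b : hom Z (T R)) :
  a ;; fmap T k = b ;; fmap T k -> a = b.
Proof.
move=> e; apply: (tangent_kernel_mono Tkk); rewrite !comp_assoc.
by rewrite e.
Qed.

Lemma Tkernel_lift Z (w : hom Z (T (T G))) :
  w ;; fmap T (p G) = gone (tangent_group G) Z -> exists a, a ;; fmap T k = w.
Proof.
move=> e; have [|a aE] := tangent_kernel_lift (u := w ;; c G) Tkk.
  by rewrite -comp_assoc c_p.
exists a; rewrite -[w]comp_idr -tan_cc [RHS]comp_assoc -aE -!comp_assoc.
by rewrite tan_cc comp_idr.
Qed.

(* [f] is the structure map of R as a differential object. *)
Lemma Tkernel_decomposition : exists f : hom (T R) R,
  fmap T k = (p R ;; k ;; z (T G)) ∙ (f ;; k ;; l G).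
Proof.
have [a aE] : exists a, a = p R ;; k ;; z (T G) by exists (p R ;; k ;; z (T G)).
have aTp : a ;; fmap T (p G) = gone (tangent_group G) (T R).
  by rewrite aE -comp_assoc -tan_z_nat comp_assoc kernel_over gone_z.
have Tkp : fmap T k ;; fmap T (p G) = gone (tangent_group G) (T R).
  by rewrite -fmap_comp kk.1 fmap_gone.
have ap : a ;; p (T G) = fmap T k ;; p (T G).
  by rewrite aE -!comp_assoc zp comp_idr tan_p_nat.
have pm := @gmul_p (tangent_group G); have pV := group_homV pm.
have Tpm := @gmul_fmap (tangent_group G) G _ (@gmul_p G).
have TpV := group_homV Tpm.
(* Both [a] and [fmap T k] lie in the kernel of [T p] and agree under [p], so their quotient lies in
   both kernels and is a vertical lift. *)
have [||v v1 vE] := @vertical_kernel G (T R) (ginv a ∙ fmap T k).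
- by rewrite Tpm TpV aTp Tkp gmulVl.
- by rewrite pm pV ap gmulVl.
have [f fE] := tangent_kernel_lift kk v1.
by exists f; rewrite fE vE -aE gmulVKl.
Qed.

(** Uniqueness of the decomposition z(u) . l(v): [p] recovers u because l(v) lies over the unit,
    then z(u) cancels and [l] is monic. *)
Lemma Tkernel_components (f : hom (T R) R) Z (a : hom Z (T R))
    (u v : hom Z (T G)) :
  fmap T k = (p R ;; k ;; z (T G)) ∙ (f ;; k ;; l G) ->
  v ;; p G = gone G Z ->
  a ;; fmap T k = (u ;; z (T G)) ∙ (v ;; l G) ->
  a ;; p R ;; k = u /\ a ;; f ;; k = v.
Proof.
move=> fE v1 aE.
have u1 : a ;; p R ;; k = u.
  rewrite -comp_assoc -tan_p_nat comp_assoc aE.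
  rewrite (@gmul_p (tangent_group G)) -!comp_assoc zp comp_idr l_p.
  by rewrite comp_assoc v1 gone_z gmul1r.
split=> //; apply/l_mono.
move: aE; rewrite fE comp_gmul !comp_assoc u1; exact: gmulI.
Qed.

(** Zero and addition come from the unit and product of [T G]. An axiom ending in [f] is proved by
    decomposing the map before [f], followed by [fmap T k], and reading off the second component. *)
Lemma kernel_diff_object : exists (D : diff_object X) (k' : hom D (T G)),
  [/\ tangent_kernel k',
      forall Z (a b : hom Z (T D)), a ;; fmap T k' = b ;; fmap T k' -> a = b
    & vertical_lift D ;; fmap T k' = k' ;; l G].
Proof.
have [f fE] := Tkernel_decomposition.
have fP Z a u v := @Tkernel_components f Z a u v fE.
have mono := tangent_kernel_mono kk.
have [o oE] : exists o : hom 𝟙 R, o ;; k = gone (tangent_group G) 𝟙.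
  by apply: (tangent_kernel_lift kk); rewrite gone_p.
have [m mE] : exists m : hom (R ** R) R, m ;; k = (π1 ;; k) ∙ (π2 ;; k).
  apply: (tangent_kernel_lift kk).
  by rewrite (@gmul_p G) !kernel_over gmul1l.
(* The inverse of [⟨p R, f⟩] sends (u, v) to z(u) . l(v), which lies in the kernel of [T p]. *)
have [j jE] : exists j : hom (R ** R) (T R),
    j ;; fmap T k = (π1 ;; k ;; z (T G)) ∙ (π2 ;; k ;; l G).
  apply: Tkernel_lift; rewrite (@gmul_fmap (tangent_group G) G _ (@gmul_p G)).
  rewrite -!(comp_assoc (_ ;; k)) -tan_z_nat l_Tp !comp_assoc !kernel_over.
  by rewrite !gone_z gmul1l.
have oE' Z : ! ;; o ;; k = gone (tangent_group G) Z.
  by rewrite -comp_assoc oE comp_gone.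
have mE' Z (u v : hom Z R) : ⟨u, v⟩ ;; m ;; k = (u ;; k) ∙ (v ;; k).
  by rewrite -comp_assoc mE comp_gmul !comp_assoc cpair_pi1 cpair_pi2.
have kC Z (u v : hom Z R) : (u ;; k) ∙ (v ;; k) = (v ;; k) ∙ (u ;; k).
  by apply: gmulC_kernel; rewrite kernel_over.
have monoid : is_monoid o m.
  split; apply: mono.
  - rewrite /cross /assoc !comp_idr [⟨_, ⟨_, _⟩⟩ ;; _]comp_cpair.
    rewrite !comp_assoc !cpair_pi1 !cpair_pi2 !mE'.
    by rewrite -(comp_assoc _ m) mE comp_gmul !comp_assoc gmulA.
  - by rewrite mE' oE' gmul1l comp_idl.
  - by rewrite mE' oE' gmul1r comp_idl.
have comm : ⟨π2, π1⟩ ;; m = m by apply: mono; rewrite mE' mE kC.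
have z_f : z R ;; f = ! ;; o.
  apply: mono; rewrite oE'.
  have [||_ ->] := fP _ (z R) k (gone _ _); rewrite ?gone_p //.
  by rewrite gone_l gmul1r tan_z_nat.
(* By interchange, z(u) . l(v1) and z(u) . l(v2) add up to z(u) . l(v1 v2): zeros add to zero, and
   lifts over the unit add by multiplication. *)
have s_f : s R ;; f = ⟨pr1 R ;; f, pr2 R ;; f⟩ ;; m.
  apply: mono; rewrite mE'.
  pose u := pr1 R ;; p R ;; k.
  pose v1 := pr1 R ;; f ;; k; pose v2 := pr2 R ;; f ;; k.
  rewrite -/v1 -/v2.
  have S : tsum (pr1 R) (pr2 R) (s R).
    by exists (idm _); rewrite !comp_idl.
  have {S} := tsum_fmap k S.
  have -> : pr1 R ;; fmap T k = (u ;; z (T G)) ∙ (v1 ;; l G).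
    by rewrite fE comp_gmul !comp_assoc.
  have -> : pr2 R ;; fmap T k = (u ;; z (T G)) ∙ (v2 ;; l G).
    by rewrite fE comp_gmul !comp_assoc -T2_over.
  have v1P : v1 ;; p G = gone _ _ by exact: kernel_over.
  have v2P : v2 ;; p G = gone _ _ by exact: kernel_over.
  move: u v1 v2 v1P v2P => u v1 v2 v1P v2P S.
  have S1 := tsum0r (u ;; z (T G)).
  rewrite -(comp_assoc u (z (T G)) (p (T G))) zp comp_idr in S1.
  have S2 : tsum (v1 ;; l G) (v2 ;; l G) ((v1 ∙ v2) ;; l G).
    rewrite gmul_l; apply: tsum_kernel; rewrite -comp_assoc l_p comp_assoc.
    - by rewrite v1P gone_z.
    - by rewrite v2P gone_z.
  have [||_ ->] := fP _ (s R) u (v1 ∙ v2) => //.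
  - by rewrite gmul_p v1P v2P gmul1l.
  - exact: tsum_fun S (tsum_gmul S1 S2).
have To_f : Tone X ;; fmap T o ;; f = o.
  apply: mono; rewrite oE.
  have [||_ ->] := fP _ (Tone X ;; fmap T o) (gone _ _) (gone _ _) => //.
  - by rewrite gone_p.
  - by rewrite gone_z gone_l gmul1l -comp_assoc -fmap_comp oE fmap_gone
      comp_gone.
have Tm_f : Tprod R R ;; fmap T m ;; f = cross f f ;; m.
  apply: mono; rewrite /cross mE'.
  have [||_ ->] := fP _ (Tprod R R ;; fmap T m)
    ((π1 ;; p R ;; k) ∙ (π2 ;; p R ;; k))
    ((π1 ;; f ;; k) ∙ (π2 ;; f ;; k)) => //.
  - by rewrite gmul_p !kernel_over gmul1l.
  rewrite -comp_assoc -fmap_comp mE fmap_gmul !fmap_comp comp_gmul !comp_assoc.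
  rewrite Tprod_pi1 Tprod_pi2 fE !comp_gmul !comp_assoc gmul_z gmul_l.
  (* Reassociation isolates l(v1) . z(u2), whose factors commute because both lie in the kernel of
     [T p]. *)
  rewrite -!gmulA; congr (_ ∙ _); rewrite !gmulA; congr (_ ∙ _).
  apply: gmulC_Tkernel; rewrite -(comp_assoc (_ ;; k)).
  - by rewrite l_Tp comp_assoc kernel_over gone_z.
  - by rewrite -tan_z_nat comp_assoc kernel_over gone_z.
have l_f : l R ;; fmap T f ;; f = f.
  (* Both sides of naturality of [l] at [k] are decomposed. The factors coming from z agree and
     cancel, and [fmap T (l G)] is monic. *)
  have key : l R ;; fmap T f ;; fmap T k = f ;; k ;; l G.
    apply: Tl_mono; apply: (gmulI (u := p R ;; k ;; z (T G) ;; l (T G))).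
    have e : p R ;; k ;; z (T G) ;; l (T G) =
        l R ;; fmap T (p R) ;; fmap T k ;; fmap T (z (T G)).
      rewrite l_Tp -!comp_assoc z_l [z R ;; _]comp_assoc -tan_z_nat.
      by rewrite -comp_assoc -tan_z_nat.
    have e' := tan_l_nat (ctc_tan X) k.
    rewrite (congr1 (fmap T) fE) fE (@gmul_l (tangent_group G)) in e'.
    rewrite fmap_gmul comp_gmul e !fmap_comp !comp_assoc in e'.
    by rewrite -(comp_assoc _ (l G)) tan_l_Tl !comp_assoc e -e'.
  apply: mono.
  have [||_ ->] := fP _ (l R ;; fmap T f) (gone _ _) (f ;; k) => //.
  - exact: kernel_over.
  - by rewrite key gone_z gmul1l.
have split_j : ⟨p R, f⟩ ;; j = idm (T R).
  apply: Tkernel_mono; rewrite -comp_assoc jE comp_gmul !comp_assoc.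
  by rewrite cpair_pi1 cpair_pi2 comp_idl -fE.
have j_split : j ;; ⟨p R, f⟩ = idm (R ** R).
  have [||j1 j2] := fP _ j (π1 ;; k) (π2 ;; k) => //; first exact: kernel_over.
  apply: cpair_ext; rewrite comp_cpair comp_idl.
  - by rewrite cpair_pi1; apply: mono.
  - by rewrite cpair_pi2; apply: mono.
pose D := DiffObject monoid comm z_f s_f To_f Tm_f l_f split_j j_split.
exists D, k; split=> //; first exact: Tkernel_mono.
rewrite /vertical_lift /= -comp_assoc jE comp_gmul !comp_assoc.
by rewrite cpair_pi1 cpair_pi2 oE' gone_z gmul1l comp_idl.
Qed.

End DiffObject.

(** * Left-invariant vector fields *)

Section LeftInvariant.

Variable H : group_object X.

Definition at_unit A (x : hom (H ** A) (T H)) : hom A (T H) :=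
  ⟨gone H A, idm A⟩ ;; x.

Lemma at_unit_over A (x : PLIVF H A) : at_unit x ;; p H = gone H A.
Proof. by rewrite /at_unit -comp_assoc plivf_over cpair_pi1. Qed.

Lemma plivf_translate A (x : PLIVF H A) Z (g h : hom Z H) (a : hom Z A) :
  ⟨g ∙ h, a⟩ ;; x = (g ;; z H) ∙ (⟨h, a⟩ ;; x).
Proof.
have := congr1 (Defs.comp ⟨⟨g, h⟩, a⟩) (plivf_invariant x).
rewrite /Tcross !comp_assoc cpair_assoc cpair_cross comp_idr.
by rewrite cpair_cross /gmul /= /tangent_gm !comp_assoc.
Qed.

(** Writing g as g . e, invariance moves g outside and leaves the value at the unit. *)
Lemma plivfE A (x : PLIVF H A) : x = (π1 ;; z H) ∙ (π2 ;; at_unit x) :> hom _ _.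
Proof.
rewrite /at_unit comp_assoc comp_cpair comp_gone comp_idr -plivf_translate.
by rewrite gmul1r -[LHS]comp_idl {1}(cpair_uniq (idm (H ** A))) !comp_idl.
Qed.

Lemma plivf_eq A (x y : PLIVF H A) : at_unit x = at_unit y -> x = y.
Proof.
move=> e; have : plivf x = plivf y by rewrite plivfE [RHS]plivfE e.
case: x y {e} => [x x1 x2] [y y1 y2] /= e; case: _ / e in y1 y2 *.
by congr MkPLIVF; apply: Prop_irrelevance.
Qed.

Section Translate.

Variables (A : X) (u : hom A (T H)).
Hypothesis u1 : u ;; p H = gone H A.

Definition translate : hom (H ** A) (T H) := (π1 ;; z H) ∙ (π2 ;; u).

Lemma translate_over : translate ;; p H = π1.
Proof.
by rewrite gmul_p -!comp_assoc zp u1 comp_gone comp_idr gmul1r.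
Qed.

Lemma translate_cpair Z (g : hom Z H) (a : hom Z A) :
  ⟨g, a⟩ ;; translate = (g ;; z H) ∙ (a ;; u).
Proof. by rewrite comp_gmul !comp_assoc cpair_pi1 cpair_pi2. Qed.

Lemma translate_invariant :
  cross (gm H) (idm A) ;; translate =
  assoc H H A ;; Tcross (z H) translate ;; fmap T (gm H).
Proof.
rewrite /Tcross (comp_assoc (assoc H H A)) cpair_cross translate_cpair.
rewrite {1}/cross comp_idr translate_cpair.
have -> : π1 ;; gm H = (π1 ;; π1) ∙ (π1 ;; π2) :> hom (H ** H ** A) H.
  by rewrite /gmul cpair_pi12.
by rewrite gmul_z -gmulA -(comp_assoc _ (Tprod H H)).
Qed.

Definition translate_plivf : PLIVF H A :=
  MkPLIVF translate_over translate_invariant.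

Lemma translate_at_unit : at_unit translate_plivf = u.
Proof. by rewrite /at_unit translate_cpair gone_z gmul1l comp_idl. Qed.

End Translate.

Section KernelRepresentation.

Variables (R : X) (k : hom R (T H)).
Hypothesis kk : tangent_kernel k.

Lemma kernel_rep_ex A (x : PLIVF H A) : exists h : hom A R, h ;; k = at_unit x.
Proof. exact/(tangent_kernel_lift kk)/at_unit_over. Qed.

Definition kernel_rep A (x : PLIVF H A) : hom A R :=
  projT1 (cid (kernel_rep_ex x)).

Lemma kernel_repE A (x : PLIVF H A) : kernel_rep x ;; k = at_unit x.
Proof. exact: projT2 (cid (kernel_rep_ex x)). Qed.

Lemma kernel_rep_inv_over A (f : hom A R) : f ;; k ;; p H = gone H A.
Proof. by rewrite -comp_assoc kk.1 comp_gone. Qed.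

Definition kernel_rep_inv A (f : hom A R) : PLIVF H A :=
  translate_plivf (kernel_rep_inv_over f).

Lemma kernel_repK A : cancel (@kernel_rep A) (@kernel_rep_inv A).
Proof. by move=> x; apply: plivf_eq; rewrite translate_at_unit kernel_repE. Qed.

Lemma kernel_rep_invK A : cancel (@kernel_rep_inv A) (@kernel_rep A).
Proof.
move=> f; apply: (tangent_kernel_mono kk).
by rewrite kernel_repE translate_at_unit.
Qed.

Lemma Lie_map_at_unit A B (f : hom A B) (x : PLIVF H B) :
  at_unit (Lie_map f x) = f ;; at_unit x.
Proof.
rewrite /at_unit /= !comp_assoc cpair_cross comp_cpair.
by rewrite !comp_idr comp_gone comp_idl.
Qed.

Lemma kernel_rep_nat A B (f : hom A B) (x : PLIVF H B) :
  kernel_rep (Lie_map f x) = f ;; kernel_rep x.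
Proof.
apply: (tangent_kernel_mono kk).
by rewrite -comp_assoc !kernel_repE Lie_map_at_unit.
Qed.

Definition kernel_representation : representation H R :=
  Representation kernel_repK kernel_rep_invK kernel_rep_nat.

Lemma kernel_representationE A (x : PLIVF H A) :
  rep kernel_representation x ;; k = at_unit x.
Proof. exact: kernel_repE. Qed.

End KernelRepresentation.

(** Yoneda: the field represented by the identity is universal, and evaluation at the unit matches
    fields with elements over the unit, so its value is the universal such element. *)
Lemma representation_kernel R (φ : representation H R) :
  tangent_kernel (at_unit (rep_inv φ (idm R))).
Proof.
pose U := rep_inv φ (idm R).
have LieU A (f : hom A R) : Lie_map f U = rep_inv φ f.
  by rewrite -[LHS](repK φ) rep_nat rep_invK comp_idr.
split; first exact: at_unit_over.
move=> A u u1; exists (rep φ (translate_plivf u1)); split.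
  by rewrite -Lie_map_at_unit LieU repK translate_at_unit.
move=> h hE; rewrite -[RHS](rep_invK φ) -LieU; congr (rep φ _); apply: plivf_eq.
by rewrite translate_at_unit Lie_map_at_unit hE.
Qed.

Lemma rep_at_unit R (φ : representation H R) A (x : PLIVF H A) :
  rep φ x ;; at_unit (rep_inv φ (idm R)) = at_unit x.
Proof.
rewrite -Lie_map_at_unit; congr at_unit; congr plivf.
by rewrite -[LHS](repK φ) rep_nat rep_invK comp_idr repK.
Qed.

(** [z] preserves units, so linearity in the parameter passes to the value at the unit;
    [translate_linear] goes back. *)
Lemma at_unit_linear A (a : hom A (T A)) (x : PLIVF H A) :
  Tcross (z H) a ;; fmap T x = x ;; l H ->
  a ;; fmap T (at_unit x) = at_unit x ;; l H.
Proof.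
move=> e; rewrite /at_unit -comp_assoc -e /Tcross fmap_comp -Tcpair.
rewrite fmap_gone fmap_id !comp_assoc comp_cpair comp_idr cpair_cross comp_idl.
by rewrite comp_gone gone_z.
Qed.

Lemma translate_linear A (a : hom A (T A)) (u : hom A (T H)) :
  a ;; fmap T u = u ;; l H ->
  Tcross (z H) a ;; fmap T (translate u) = translate u ;; l H.
Proof.
move=> e; rewrite /translate fmap_gmul comp_gmul !fmap_comp gmul_l /Tcross.
rewrite !(comp_assoc (cross _ _ ;; _)) -!(comp_assoc _ (Tprod _ _)).
rewrite Tprod_pi1 Tprod_pi2 /cross cpair_pi1 cpair_pi2.
by rewrite -!comp_assoc e z_l tan_z_nat.
Qed.

Lemma kernel_translate_iso R (k : hom R (T H)) :
  tangent_kernel k -> is_iso (translate k).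
Proof.
move=> kk; pose b := p H ;; z H.
have pV := group_homV (@gmul_p H).
have bp : b ;; p H = p H by rewrite -comp_assoc zp comp_idr.
(* The inverse is v -> (p v, z(p v)^-1 . v); [d] is its second component. *)
have [|d dE] := @tangent_kernel_lift H R k _ (ginv b ∙ idm (T H)) kk.
  by rewrite gmul_p pV bp comp_idl gmulVl.
exists ⟨p H, d⟩; split; last by rewrite translate_cpair dE gmulVKl.
apply: cpair_ext; rewrite -comp_assoc ?cpair_pi1 ?cpair_pi2 comp_idl.
  exact: translate_over kk.1.
apply: (tangent_kernel_mono kk); rewrite -comp_assoc dE comp_gmul comp_idr.
rewrite (_ : translate k ;; ginv b = ginv (π1 ;; z H)) ?gmulKl //.
by rewrite /ginv /b !comp_assoc (translate_over kk.1).
Qed.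

End LeftInvariant.

(** * Iterated tangent groups and the four conditions *)

Lemma iter_fmap_id n A : iter_fmap T n (idm A) = idm (iter n T A).
Proof. by elim: n => //= n ->; rewrite fmap_id. Qed.

Lemma iter_fmap_comp n A B D (f : hom A B) (g : hom B D) :
  iter_fmap T n (f ;; g) = iter_fmap T n f ;; iter_fmap T n g.
Proof. by elim: n => //= n ->; rewrite fmap_comp. Qed.

Lemma iter_one_terminal n Z (f g : hom Z (iter n T 𝟙)) : f = g.
Proof.
(* The induction carries a point through which all maps into the object factor; applied to the
   identity, this passes through [T]. *)
suff [t tE] : exists t : hom 𝟙 (iter n T 𝟙),
    forall Y (h : hom Y (iter n T 𝟙)), h = ! ;; t by rewrite (tE _ f) [RHS]tE.
elim: n {Z f g} => [|n [t tE]] /=.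
  by exists (idm _) => Y h; apply: bang_one.
exists (Tone X ;; fmap T t) => Y h.
rewrite -[LHS]comp_idr -fmap_id (tE _ (idm _)) fmap_comp !comp_assoc.
congr (_ ;; _); rewrite -[LHS]comp_idr -(bang_Fone (ctc_pres X)) comp_assoc.
by congr (_ ;; _); apply: bang_one.
Qed.

Lemma iter_prod n A B :
  exists j : hom (iter n T A ** iter n T B) (iter n T (A ** B)),
  [/\ j ;; iter_fmap T n π1 = π1, j ;; iter_fmap T n π2 = π2
    & ⟨iter_fmap T n π1, iter_fmap T n π2⟩ ;; j = idm _].
Proof.
elim: n => [|n [j [j1 j2 j3]]] /=.
  exists (idm _); rewrite !comp_idl comp_idr; split=> //.
  by apply: cpair_ext; rewrite ?cpair_pi1 ?cpair_pi2 comp_idl.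
exists (Tprod _ _ ;; fmap T j).
rewrite -!comp_assoc -!fmap_comp j1 j2 Tprod_pi1 Tprod_pi2; split=> //.
by rewrite comp_assoc Tcpair -fmap_comp j3 fmap_id.
Qed.

Lemma iter_cpair_ext n A B Z (f g : hom Z (iter n T (A ** B))) :
  f ;; iter_fmap T n π1 = g ;; iter_fmap T n π1 ->
  f ;; iter_fmap T n π2 = g ;; iter_fmap T n π2 -> f = g.
Proof.
have [j [_ _ jE]] := iter_prod n A B => e1 e2.
by rewrite -[f]comp_idr -[g]comp_idr -jE !comp_assoc !comp_cpair e1 e2.
Qed.

Lemma is_iso_comp A B D (f : hom A B) (g : hom B D) :
  is_iso f -> is_iso g -> is_iso (f ;; g).
Proof.
move=> [f' [f1 f2]] [g' [g1 g2]]; exists (g' ;; f'); split.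
- by rewrite -!comp_assoc [g ;; _]comp_assoc g1 comp_idl.
- by rewrite -!comp_assoc [f' ;; _]comp_assoc f2 comp_idl.
Qed.

Lemma is_iso_fmap A B (f : hom A B) : is_iso f -> is_iso (fmap T f).
Proof.
by move=> [g [e1 e2]]; exists (fmap T g); rewrite -!fmap_comp e1 e2 !fmap_id.
Qed.

Lemma is_iso_idm A : is_iso (idm A).
Proof. by exists (idm A); rewrite comp_idl. Qed.

Lemma is_iso_mono A B (f : hom A B) Z (u v : hom Z A) :
  is_iso f -> u ;; f = v ;; f -> u = v.
Proof.
move=> [g [e _]] uv.
by rewrite -[u]comp_idr -[v]comp_idr -e !comp_assoc uv.
Qed.

(* The carriers [iter n T G] and [iter_tangent_group n G] are convertible only
   for closed [n]. *)
Fixpoint iter_carrier G n : hom (iter n T G) (iter_tangent_group n G) :=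
  if n is m.+1 then fmap T (iter_carrier G m) else idm G.

(** Moves the innermost [T] to the outside, which turns T^n p into [p] of the n-th tangent group. *)
Fixpoint iter_flip G n : hom (iter n T (T G)) (T (iter_tangent_group n G)) :=
  match n with
  | 0 => idm (T G)
  | m.+1 => fmap T (iter_flip G m) ;; c (iter_tangent_group m G)
  end.

Lemma iter_carrier_iso G n : is_iso (iter_carrier G n).
Proof. by elim: n => [|n IHn] /=; [apply: is_iso_idm | apply: is_iso_fmap]. Qed.

Lemma iter_flip_iso G n : is_iso (iter_flip G n).
Proof.
elim: n => [|n IHn] /=; first exact: is_iso_idm.
by apply: is_iso_comp (c_iso _); apply: is_iso_fmap.
Qed.

Lemma iter_flip_p G n :
  iter_flip G n ;; p (iter_tangent_group n G) =
  iter_fmap T n (p G) ;; iter_carrier G n.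
Proof.
elim: n => [|n IHn] /=; first by rewrite comp_idl comp_idr.
by rewrite -comp_assoc c_p -!fmap_comp IHn.
Qed.

Lemma iter_unit G n :
  iter_fmap T n (ge G) ;; iter_carrier G n = gone (iter_tangent_group n G) _.
Proof.
elim: n => [|n IHn] /=; last by rewrite -fmap_comp IHn fmap_gone.
by rewrite comp_idr /gone (bang_one ! (idm _)) comp_idl.
Qed.

(** Level n of the tangent pullback concerns T^n p and T^n e; [iter_flip] and [iter_carrier]
    identify these with [p] and the unit of T^n G. *)
Lemma iter_kernel G R (k : hom R (T G)) n :
  is_tangent_pullback T (p G) (ge G) k (! : hom R 𝟙) ->
  tangent_kernel (iter_fmap T n k ;; iter_flip G n).
Proof.
move=> /(_ n) [kE kU]; split.
  rewrite -comp_assoc iter_flip_p comp_assoc kE -comp_assoc iter_unit.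
  by rewrite comp_gone.
move=> Z u u1; have [g [fg gf]] := iter_flip_iso G n.
(* The pullback asks for a map to T^n 1; iterated zeros provide one. *)
have [t _] : exists t : hom Z (iter n T 𝟙), True.
  elim: n {kE kU u u1 g fg gf} => [|n [t _]]; first by exists !.
  by exists (t ;; z _).
have [|h [[h1 _] hU]] := kU Z (u ;; g) t.
  apply: (is_iso_mono (iter_carrier_iso G n)).
  rewrite -!comp_assoc -iter_flip_p iter_unit comp_gone.
  by rewrite [g ;; _]comp_assoc gf comp_idl u1.
exists h; split; first by rewrite comp_assoc h1 -comp_assoc gf comp_idr.
move=> h' h'E; apply: hU; split; last exact: iter_one_terminal.
by rewrite -h'E -!comp_assoc fg comp_idr.
Qed.

(** * Implications between the four conditions *)

Lemma Lie_group_tangently_representable G :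
  is_Lie_group G -> tangently_representable G.
Proof.
move=> [R [k kP]].
exists R, (fun n => kernel_representation (iter_kernel n kP)).
(* The value of [tau x] at the unit is T of the value of x, followed by [c]; [iter_flip] at n+1 ends
   with the same [c]. *)
move=> n A x; apply: (tangent_kernel_mono (iter_kernel n.+1 kP)).
rewrite kernel_representationE [iter_flip G n.+1]/= !comp_assoc -!fmap_comp.
rewrite -[_ ;; _ ;; iter_flip G n]comp_assoc kernel_representationE.
rewrite /at_unit /= /tau_map !comp_assoc.
by rewrite -fmap_gone -fmap_id Tcpair -fmap_comp.
Qed.

(** The universal field at level 1 is [tau] of the one at level 0, so [fmap T k ;; c G] is a kernel,
    as [kernel_diff_object] requires. Multilinearity is then compared through values at the unit. *)
Lemma tangently_differentiably_representable G :
  tangently_representable G -> differentiably_representable G.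
Proof.
move=> [R [φ φ_tau]].
pose k : hom R (T G) := at_unit (rep_inv (φ 0) (idm R)).
have kk : tangent_kernel k := representation_kernel (φ 0).
have Tkk : @tangent_kernel (tangent_group G) (T R) (fmap T k ;; c G).
  have := representation_kernel (φ 1).
  have -> : rep_inv (φ 1) (idm (iter 1 T R)) = tau (rep_inv (φ 0) (idm R)).
    by rewrite -[RHS](repK (φ 1)) φ_tau rep_invK fmap_id.
  rewrite {1}/at_unit /= /tau_map !comp_assoc.
  by rewrite -fmap_gone -fmap_id Tcpair -fmap_comp.
have [D [k' [kk' Tmono lift]]] := kernel_diff_object kk Tkk.
exists D, (kernel_representation kk') => As; split=> [x xM | f fM] i iAs.
- apply: Tmono; rewrite -(comp_assoc _ (vertical_lift D)) lift -comp_assoc.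
  rewrite -fmap_comp comp_assoc.
  rewrite kernel_representationE; exact/at_unit_linear/xM.
- apply: translate_linear.
  rewrite fmap_comp comp_assoc fM // -(comp_assoc _ (vertical_lift D)) lift.
  by rewrite comp_assoc.
Qed.

(** The identity of the representing object is linear, hence so is the corresponding field;
    translating its value at the unit gives the inverse of ν. *)
Lemma differentiably_representable_parallelizable G :
  differentiably_representable G -> parallelizable G.
Proof.
move=> [D [φ /(_ [:: D]) [_ φ_inv]]].
pose k : hom D (T G) := at_unit (rep_inv φ (idm D)).
have kk : tangent_kernel k := representation_kernel φ.
have k_linear : vertical_lift D ;; fmap T k = k ;; l G.
  (* [dprod [:: D]] is D x 1, so the identity appears as [π1]; composing with [⟨idm D, !⟩] removes
     the factor 1 later. *)
  have π1M : @multilinear X [:: D] D π1.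
    by case=> // _; rewrite /= /Tcross -comp_assoc Tprod_pi1 /cross cpair_pi1.
  have := at_unit_linear (φ_inv _ π1M 0 isT).
  rewrite -(rep_at_unit φ) rep_invK -/k fmap_comp !comp_assoc /= /Tcross.
  rewrite -(comp_assoc _ _ (fmap T π1)) Tprod_pi1 /cross cpair_pi1 => e.
  have := congr1 (Defs.comp ⟨idm D, !⟩) e.
  by rewrite !comp_assoc cpair_pi1 !comp_idl.
have [ν [ν1 ν2]] := kernel_translate_iso kk.
exists D, ν; split; first by exists (translate k).
rewrite -[LHS]comp_idr -fmap_id -ν1 fmap_comp comp_assoc -(comp_assoc ν).
by rewrite translate_linear // comp_assoc ν2 comp_idl.
Qed.

(* Linearity of ν only gives ν π1 = p α for an automorphism α of M, so the
   fibre over x is D embedded by d |-> ν^-1 (α x, d). *)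
Lemma parallelizable_tangent_fibre M (x : hom 𝟙 M) :
  parallelizable M ->
  exists (TxM : X) (k : hom TxM (T M)),
    is_tangent_pullback T (p M) x k (! : hom TxM 𝟙).
Proof.
move=> [D [ν [[μ [νμ μν]] ν_linear]]].
(* [α] is the base component of ν on zero vectors, and [β] the base point of [μ] on (m, 0). *)
pose α := z M ;; ν ;; π1; pose β := ⟨idm M, ! ;; dzero D⟩ ;; μ ;; p M.
(* Linearity followed by [p]: through ν, replacing a vector by zero becomes replacing its
   D-component by zero. *)
have e : ν ;; ⟨π1, ! ;; dzero D⟩ = p M ;; z M ;; ν.
  have e := congr1 (fun f => f ;; p _) ν_linear.
  rewrite -!comp_assoc tan_p_nat [l M ;; _]comp_assoc l_p in e.
  rewrite -e; congr (_ ;; _).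
  apply: cpair_ext; rewrite -!comp_assoc -tan_p_nat !comp_assoc.
  - by rewrite /Tcross -(comp_assoc _ (Tprod _ _)) Tprod_pi1 !cpair_pi1
      -comp_assoc zp comp_idr.
  - rewrite /Tcross -(comp_assoc _ (Tprod _ _)) Tprod_pi2 !cpair_pi2.
    by rewrite -comp_assoc vertical_lift_p comp_assoc (bang_one (π2 ;; !) !).
have ν_π1 : ν ;; π1 = p M ;; α.
  have := congr1 (fun f => f ;; π1) e.
  by rewrite /α -!comp_assoc cpair_pi1.
have μ_p : μ ;; p M = π1 ;; β.
  have := congr1 (fun f => μ ;; f ;; (μ ;; p M)) e.
  rewrite !comp_assoc μν comp_idl -(comp_assoc _ ν) νμ comp_idr.
  rewrite -(comp_assoc _ (z M)) zp comp_idr => <-.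
  by rewrite comp_cpair comp_idr comp_assoc (bang_one (π1 ;; !) !).
clearbody α β; have αβ : p M ;; α ;; β = p M.
  by rewrite -ν_π1 -comp_assoc -μ_p comp_assoc νμ comp_idl.
have αβ1 : α ;; β = idm M.
  by rewrite -[LHS]comp_idl -zp -!comp_assoc [p M ;; _]comp_assoc αβ.
pose k := ⟨! ;; (x ;; α), idm D⟩ ;; μ.
have kν : k ;; ν = ⟨! ;; (x ;; α), idm D⟩ by rewrite -comp_assoc μν comp_idr.
have kp : k ;; p M = ! ;; x.
  by rewrite -comp_assoc μ_p comp_assoc cpair_pi1 -!comp_assoc αβ1 comp_idr.
exists D, k => n; split; first by rewrite -!iter_fmap_comp kp.
(* The lift of [u] is its D-component under ν. Agreement with [u] is tested after ν, where the base
   components match by [ν_π1] and [uv]. *)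
move=> Z u v uv; exists (u ;; iter_fmap T n (ν ;; π2)); split; last first.
  move=> h [<- _]; rewrite -comp_assoc -iter_fmap_comp comp_assoc kν cpair_pi2.
  by rewrite iter_fmap_id comp_idr.
split; last exact: iter_one_terminal.
rewrite -[RHS]comp_idr -iter_fmap_id -νμ [in RHS]iter_fmap_comp [RHS]comp_assoc.
rewrite /k [iter_fmap T n (_ ;; μ)]iter_fmap_comp [LHS]comp_assoc.
congr (_ ;; _).
apply: iter_cpair_ext; rewrite -!comp_assoc -!iter_fmap_comp.
- rewrite cpair_pi1 ν_π1 !iter_fmap_comp !comp_assoc uv.
  by congr (_ ;; _ ;; _); apply: iter_one_terminal.
- by rewrite cpair_pi2 comp_idr.
Qed.

End LieGroups.

Theorem theorem4p20 (X : cartesian_tangent_category) (G : group_object X) :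
  [<-> is_Lie_group G;
       admits_negatives G /\ tangently_representable G;
       admits_negatives G /\ differentiably_representable G;
       parallelizable G].
Proof.
tfae.
- move=> GL; split; first exact: group_negatives.
  exact: Lie_group_tangently_representable.
- move=> [? ?]; split=> //; exact: tangently_differentiably_representable.
- move=> [_]; exact: differentiably_representable_parallelizable.
- exact: parallelizable_tangent_fibre.
Qed.
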